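(* Let $r\ge 2$ and $1\le i\le r$ be integers, $q$ complex with $|q|<1$, and $z$ a nonzero complex number such that no denominator below vanishes. Then \begin{align*} \sum_{k\in\Lambda^{r-1}}\frac{q^{\sum_{j=1}^{r-1}k_j^2+\sum_{j=i}^{r-1}k_j}\,z^{2\sum_{j=1}^{r-1}k_j}}{(zq;q)_{k_{r-1}}\prod_{j=1}^{r-2}(q;q)_{k_j-k_{j+1}}} ={}&\frac{(1/z;q)_\infty}{(1/z^2,z^2q;q)_\infty}(q^{2r+1};q^{2r+1})_\infty\\ &\times\left[(z^{2r+1}q^{2r+1-i},z^{-2r-1}q^i;q^{2r+1})_\infty+z^{2i-1-2r}(z^{2r+1}q^i,z^{-2r-1}q^{2r+1-i};q^{2r+1})_\infty\right]. \end{align*}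
   Context: For complex $x$ and $k\in\mathbb Z\cup\{\infty\}$ the $q$-shifted factorial is $(x;q)_0=1$, $(x;q)_k=\prod_{j=1}^k(1-xq^{j-1})$ for $k>0$ (including $k=\infty$), and $(x;q)_k=\prod_{j=1}^{-k}(1-xq^{-j})^{-1}$ for $k<0$; $(x_1,\dots,x_m;q)_k=\prod_l(x_l;q)_k$. For $r\ge2$, $k=(k_1,\dots,k_{r-1})$ and $\Lambda^{r-1}=\{k\in\mathbb Z^{r-1}:\infty>k_1\ge\dots\ge k_{r-1}>-\infty\}$. Empty products are $1$, empty sums $0$. *)

(* Defs.v *)
From mathcomp Require Export all_boot all_order all_algebra.
From mathcomp Require Export all_classical all_reals topology normedtype.
From mathcomp Require Export complex.
From mathcomp Require analysis.showcase.summability.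

Set Implicit Arguments.
Unset Strict Implicit.
Unset Printing Implicit Defensive.

Import Order.TTheory GRing.Theory Num.Theory.
Import numFieldTopology.Exports numFieldNormedType.Exports.

Local Open Scope classical_set_scope.
Local Open Scope ring_scope.

(* [Negz n] is the integer - n.+1; the inverse of 0 is 0, so [qpoch x q k] with
   k < 0 is nonzero exactly when none of the factors 1 - x q^(-j) vanishes. *)
Definition qpoch (K : numFieldType) (x q : K) (k : int) : K :=
  match k with
  | Posz n => \prod_(1 <= j < n.+1) (1 - x * q ^+ j.-1)
  | Negz n => \prod_(1 <= j < n.+2) (1 - x * q ^- j)^-1
  end.

Definition qpochoo (K : numFieldType) (x q : K) : K :=
  lim (qpoch x q n%:Z @[n --> \oo]).

Definition qpochsoo (K : numFieldType) (xs : seq K) (q : K) : K :=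
  \prod_(x <- xs) qpochoo x q.

Definition Lambda (n : nat) : Type := {k : n.-tuple int | sorted >=%R k}.

(* k_j, with 1 <= j <= n *)
Definition entry (n : nat) (k : Lambda n) (j : nat) : int := (val k)`_j.-1.

(* Unordered sum: the net of the sums over the finite subsets of I, directed by
   inclusion, converges to s. For K the complex numbers this amounts to
   absolute convergence with sum s. *)
Definition has_sum (I : choiceType) (K : numFieldType) (f : I -> K) (s : K) :
    Prop :=
  summability.partial_sum f @ summability.totally --> s.

(* Main.v *)
Require Import Defs.
From mathcomp Require Import ring lra zify finmap sequences exp.

(**
Write P(k) = 1/(q;q)_k, which vanishes for k < 0, so that the ordering of the
k_j is enforced by the factors P(k_j - k_{j+1}). Multiplying the summand by
P(N - k_1) P(N + k_{r-1}) makes the sum finite, and this truncated sum is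
evaluated by a Bailey chain relative to z^2 whose indices run over [-N, N]:
r - i steps relative to z^2 q, a change of parameter from z^2 q to z^2, and
i - 1 steps relative to z^2. Truncating is essential: the untruncated bilateral
Bailey pair does not converge. The two q-hypergeometric sums behind the chain
(the Bailey kernel and the initial pair) are proved by telescoping. As N tends
to infinity, dominated convergence (Tannery) turns the left-hand side into the
multiple sum and the right-hand side into two theta series, which Jacobi's
triple product evaluates; that product is itself the limit of its finite form.
*)

Set Implicit Arguments.
Unset Strict Implicit.
Unset Printing Implicit Defensive.

Import Order.TTheory GRing.Theory Num.Theory.
Import numFieldTopology.Exports numFieldNormedType.Exports.

Local Open Scope ring_scope.

Local Arguments qpoch : simpl never.

(** * Bilateral Bailey chains *)

(** The finite identities treat [P], [V] and [W] as functions on the integers known only through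
    one-step recurrences. These hold at every index, also where [P] vanishes, so [field] checks each
    telescoping certificate without distinguishing cases; in the chain the denominators come from
    [q], [V] and [W] and are nonzero because [z^2 q^e] is never 1. The modulus [2r+1] has this
    origin: each of the [r-1] steps multiplies [alpha_j] by [z^(2j) q^(j^2)], up to a power [q^j],
    and the initial [alpha_j], stripped of its factor [1 - z^2 q^(2j+1)], tends to a constant times
    [(-1)^j z^(3j) q^((3j^2+j)/2)]. The two theta series are the two terms of
    [alpha_j - z^2 q^(2j-1) alpha_(j-1)], which the change of parameter substitutes for
    [alpha_j (1 - z^2 q^(2j+1))]. *)

Definition zrange (N : nat) : seq int :=
  [seq n%:Z - N%:Z | n <- iota 0 N.*2.+1].

Lemma mem_zrange N k : (k \in zrange N) = (- N%:Z <= k <= N%:Z).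
Proof.
apply/mapP/idP => [[n]|kN]; first by rewrite mem_iota => nN ->; lia.
by exists (absz (k + N%:Z)); rewrite ?mem_iota; lia.
Qed.

Lemma uniq_zrange N : uniq (zrange N).
Proof. by rewrite map_inj_uniq ?iota_uniq// => m n; lia. Qed.

Lemma telescope_zrange (V : zmodType) N (G : int -> V) :
  \sum_(k <- zrange N) (G (k + 1) - G k) = G (N%:Z + 1) - G (- N%:Z).
Proof.
rewrite big_map -[iota _ _]/(index_iota 0 N.*2.+1).
rewrite (telescope_sumr_eq (fun n => G (n%:Z - N%:Z)))//.
  by congr (G _ - G _); lia.
by move=> n _; congr (G _ - G _); lia.
Qed.

(** Common pattern of the certificates [G]: a factor, mostly a [P] at a negative index, makes them
    vanish at both ends. *)
Lemma eq_sum_telescope (V : zmodType) N (G F F' : int -> V) :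
  G (N%:Z + 1) = 0 -> G (- N%:Z) = 0 ->
  (forall k, F k = F' k + (G (k + 1) - G k)) ->
  \sum_(k <- zrange N) F k = \sum_(k <- zrange N) F' k.
Proof.
move=> GN G0 FF'; under eq_bigr do rewrite FF'.
by rewrite big_split /= telescope_zrange GN G0 subrr addr0.
Qed.

Lemma big_zrange_single (V : zmodType) N (F : int -> V) j :
  - N%:Z <= j <= N%:Z -> (forall k, k != j -> F k = 0) ->
  \sum_(k <- zrange N) F k = F j.
Proof.
move=> jN F0; rewrite (bigD1_seq j) ?uniq_zrange ?mem_zrange//=.
by rewrite big1_seq ?addr0// => k /andP[/F0].
Qed.

Lemma expfzSquareS (K : fieldType) (x : K) (k : int) :
  x != 0 -> x ^ ((k + 1) * (k + 1)) = x ^ (k * k) * x ^ k * x ^ k * x.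
Proof.
move=> x0; have -> : (k + 1) * (k + 1) = k * k + k + k + 1 by lia.
by rewrite !expfzDr.
Qed.

Section BaileyChain.
Variables (K : fieldType) (q : K) (P : int -> K).
Hypotheses (q0 : q != 0) (q1 : forall n, 1 - q ^+ n.+1 != 0).
Hypothesis P0 : P 0 = 1.
Hypothesis P_lt0 : forall k : int, k < 0 -> P k = 0.
Hypothesis P_pred : forall k : int, P (k - 1) = (1 - q ^ k) * P k.

Section Kernel.
Variables (a : K) (W : int -> K).
Hypothesis a0 : a != 0.
Hypothesis W0 : forall k, W k != 0.
Hypothesis W_pred : forall k, W k = W (k - 1) * (1 - a * q ^ k).

Lemma onem_aq (k : int) : 1 - a * q ^ k != 0.
Proof. by have := W0 k; rewrite W_pred mulf_eq0 negb_or => /andP[]. Qed.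

(** For [k = j + l] and [x = a q^(2j+c)] this is the limiting q-Chu-Vandermonde sum of
    [x^l q^(l^2) / ((q)_l (q)_(n-l) (xq)_l)], with value [1 / ((q)_n (xq)_n)]. The bounds on [j] and
    [m] make the range contain the support [j <= k <= m]. Shifting the index by [c] lets one [W]
    serve all parameters [a q^c], since [(a q^(c+1))_n = W (n + c) / W c]. *)
Lemma bailey_kernel (c : int) N (j m : int) :
  - N%:Z <= j -> m <= N%:Z ->
  \sum_(k <- zrange N) (a * q ^ c) ^ k * q ^ (k * k) * P (m - k) * P (k - j)
                       / W (k + j + c)
  = (a * q ^ c) ^ j * q ^ (j * j) * P (m - j) / W (m + j + c).
Proof.
move=> jN; have [mj _|] := ltP m j.
  rewrite [P (m - j)]P_lt0 ?mulr0 ?mul0r; last by lia.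
  apply: big1_seq => k _; have [kj|kj] := ltP k j.
    by rewrite (P_lt0 (k := k - j)) ?mulr0 ?mul0r//; lia.
  by rewrite (P_lt0 (k := m - k)) ?mulr0 ?mul0r//; lia.
move=> jm; have [n ->] : exists n : nat, m = j + n%:Z.
  by exists (absz (m - j)); lia.
elim: n => [|n IHn] {m jm} mN.
  rewrite addr0 (big_zrange_single (j := j)) ?subrr ?P0 ?mulr1//; first by lia.
  move=> k kj; have [kltj|kgej] := ltP k j.
    by rewrite (P_lt0 (k := k - j)) ?mulr0 ?mul0r//; lia.
  by rewrite (P_lt0 (k := j - k)) ?mulr0 ?mul0r//; lia.
have {IHn} := IHn _; set m := j + n.+1%:Z in mN *.
have -> : j + n%:Z = m - 1 by rewrite /m; lia.
move=> /(_ ltac:(lia)) IHn.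
have Am : 1 - q ^ (m - j) != 0.
  have -> : m - j = n.+1%:Z by rewrite /m; lia.
  exact: q1.
have Bm := onem_aq (m + j + c).
have qn0 k : q ^ k != 0 by rewrite expfz_neq0.
have aqc0 : a * q ^ c != 0 by rewrite mulf_neq0.
apply: (mulfI (mulf_neq0 Am Bm)).
(* G is the q-WZ certificate of the recurrence in m obtained by clearing the
   factor (1 - q^(m-j)) (1 - a q^(m+j+c)) from the claimed value. *)
pose G k := - q ^ (m - k) * (a * q ^ c) ^ k * q ^ (k * k) * P (m - k)
             * P (k - j - 1) / W (k + j + c - 1).
have GN : G (N%:Z + 1) = 0.
  by rewrite /G (P_lt0 (k := m - _)) ?mulr0 ?mul0r//; lia.
have G0 : G (- N%:Z) = 0.
  by rewrite /G (P_lt0 (k := _ - _ - 1)) ?mulr0 ?mul0r//; lia.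
rewrite mulr_sumr; transitivity (\sum_(k <- zrange N)
    (a * q ^ c) ^ k * q ^ (k * k) * P (m - 1 - k) * P (k - j)
    / W (k + j + c)).
  apply: (eq_sum_telescope GN G0) => k; rewrite /G.
  have -> : m - 1 - k = m - k - 1 by lia.
  have -> : m - (k + 1) = m - k - 1 by lia.
  have -> : k + 1 - j - 1 = k - j by lia.
  have -> : k + 1 + j + c - 1 = k + j + c by lia.
  rewrite !P_pred [W (k + j + c)]W_pred expfzSquareS//.
  have W1 := W0 (k + j + c - 1); have W2 := onem_aq (k + j + c).
  move: W2; rewrite !expfzDr// -!invr_expz !expr1z => W2.
  by field; rewrite !qn0 q0 W1 W2.
rewrite IHn.
have -> : m - 1 - j = m - j - 1 by lia.
have -> : m - 1 + j + c = m + j + c - 1 by lia.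
rewrite P_pred [W (m + j + c)]W_pred.
have W1 := W0 (m + j + c - 1).
by field; rewrite W1 Bm.
Qed.

(** Bailey's lemma with both free parameters sent to infinity: exchange the two sums and evaluate
    the inner one by the kernel. *)
Lemma bailey_step (c : int) N (alpha beta : int -> K) :
  (forall k, - N%:Z <= k <= N%:Z ->
     beta k = \sum_(j <- zrange N) alpha j * P (k - j) / W (k + j + c)) ->
  forall m, m <= N%:Z ->
  \sum_(k <- zrange N) (a * q ^ c) ^ k * q ^ (k * k) * P (m - k) * beta k
  = \sum_(j <- zrange N) (a * q ^ c) ^ j * q ^ (j * j) * alpha j * P (m - j)
                          / W (m + j + c).
Proof.
move=> betaE m mN.
transitivity (\sum_(k <- zrange N) \sum_(j <- zrange N) alpha j *
  ((a * q ^ c) ^ k * q ^ (k * k) * P (m - k) * P (k - j) / W (k + j + c))).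
  rewrite big_seq_cond [RHS]big_seq_cond; apply: eq_bigr => k.
  rewrite andbT mem_zrange => kN; rewrite betaE// mulr_sumr.
  by apply: eq_bigr => j _; ring.
rewrite exchange_big /= big_seq_cond [RHS]big_seq_cond; apply: eq_bigr => j.
rewrite andbT mem_zrange => jN; rewrite -mulr_sumr bailey_kernel//; last by lia.
by ring.
Qed.

(* Change of parameter: turns a pair relative to a q into one relative to a. *)
Lemma bailey_switch N (g : int -> K) m :
  g (- N%:Z - 1) = 0 -> m <= N%:Z ->
  \sum_(j <- zrange N) g j * (1 - a * q ^ (2 * j + 1)) * P (m - j)
                        / W (m + j + 1)
  = \sum_(j <- zrange N) (g j - a * q ^ (2 * j - 1) * g (j - 1)) * P (m - j)
                        / W (m + j).
Proof.
move=> gN mN.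
(* The certificate comes from [1 - a q^(2j+1) = (1 - a q^(m+j+1)) - a q^(2j+1) (1 - q^(m-j))]: the
   first part lowers the index of [W], the second that of [P], which gives a term of the new sum at
   [j + 1]. *)
pose G j := - a * q ^ (2 * j - 1) * g (j - 1) * P (m - j) / W (m + j).
have GN : G (N%:Z + 1) = 0.
  by rewrite /G (P_lt0 (k := m - _)) ?mulr0 ?mul0r//; lia.
have G0 : G (- N%:Z) = 0 by rewrite /G gN !(mulr0, mul0r).
have qn0 k : q ^ k != 0 by rewrite expfz_neq0.
apply: (eq_sum_telescope GN G0) => k; rewrite /G.
have -> : k + 1 - 1 = k by lia.
have -> : m - (k + 1) = m - k - 1 by lia.
have -> : m + (k + 1) = m + k + 1 by lia.
have -> : 2 * (k + 1) - 1 = k + k + 1 by lia.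
have -> : 2 * k + 1 = k + k + 1 by lia.
have -> : 2 * k - 1 = k + k - 1 by lia.
have W2 := onem_aq (m + k + 1).
rewrite P_pred [W (m + k + 1)]W_pred.
have -> : m + k + 1 - 1 = m + k by lia.
have W1 := W0 (m + k).
move: W2; rewrite !expfzDr// -!invr_expz !expr1z => W2.
by field; rewrite !qn0 q0 W1 W2.
Qed.
End Kernel.

(** * The initial pair and the iterated chain *)

Section Base.
Variables (z : K) (V W : int -> K).
Hypothesis z0 : z != 0.
Hypotheses (V0 : forall k, V k != 0) (W0 : forall k, W k != 0).
Hypothesis V_pred : forall k, V k = V (k - 1) * (1 - z * q ^ k).
Hypothesis W_pred : forall k, W k = W (k - 1) * (1 - z ^+ 2 * q ^ k).

(** With [j = l - N] and [b = z^2 q^(1-2N)] this is the terminating very-well-poised 6phi5 sum in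
    which one free parameter is infinite and the other is [z q^(1-N)], a square root of [bq], so
    that its symbols cancel between numerator and denominator. *)
Lemma bailey_base N m : - N%:Z <= m <= N%:Z ->
  P (N%:Z + m) / V m
  = \sum_(j <- zrange N)
      z ^ (j + N%:Z) * q ^ (j * j + j * N%:Z) * W (j - N%:Z) * P (j + N%:Z)
      / V (- N%:Z)
      * (1 - z ^+ 2 * q ^ (2 * j + 1)) * P (m - j) / W (m + j + 1).
Proof.
move=> /andP[Nm]; have [n ->] : exists n : nat, m = n%:Z - N%:Z.
  by exists (absz (m + N%:Z)); lia.
have qn0 k : q ^ k != 0 by rewrite expfz_neq0.
have zn0 k : z ^ k != 0 by rewrite expfz_neq0.
elim: n => [|n IHn] {m Nm} mN.
  rewrite (big_zrange_single (j := - N%:Z)); last 2 first.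
  - by lia.
  - move=> k kj; have [kltj|kgej] := ltP k (- N%:Z).
      by rewrite (P_lt0 (k := k + N%:Z)) ?(mulr0, mul0r)//; lia.
    by rewrite (P_lt0 (k := 0 - N%:Z - k)) ?mulr0 ?mul0r//; lia.
  have -> : - N%:Z * - N%:Z + - N%:Z * N%:Z = 0 by lia.
  rewrite sub0r opprK subrr addNr P0.
  rewrite !expr0z !mul1r !mulr1.
  have -> : 2 * - N%:Z + 1 = - N%:Z - N%:Z + 1 by lia.
  rewrite [W (_ + 1)]W_pred addrK.
  have W2 := onem_aq W0 W_pred (- N%:Z - N%:Z + 1).
  by field; rewrite W2 V0 W0.
have {IHn} := IHn _; set m := n.+1%:Z - N%:Z in mN *.
have -> : n%:Z - N%:Z = m - 1 by rewrite /m; lia.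
move=> /(_ ltac:(lia)) IHn.
have Am : 1 - q ^ (N%:Z + m) != 0.
  have -> : N%:Z + m = n.+1%:Z by rewrite /m; lia.
  exact: q1.
have Bm := onem_aq V0 V_pred m; clearbody m.
apply: (mulfI (mulf_neq0 Am Bm)).
transitivity (P (N%:Z + (m - 1)) / V (m - 1)).
  have -> : N%:Z + (m - 1) = N%:Z + m - 1 by lia.
  have V1 := V0 (m - 1).
  by rewrite P_pred [V m]V_pred; field; rewrite V1 Bm.
rewrite IHn mulr_sumr.
(* q-WZ certificate of the recurrence in [m] cleared of [(1 - q^(N+m)) (1 - z q^m)]. *)
pose G j := z ^ (j + N%:Z) * q ^ (j * j + j * N%:Z) * W (j - N%:Z)
  * P (j + N%:Z - 1) / V (- N%:Z) * P (m - j) / W (m + j)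
  * (z * q ^ m - q ^ (m - j)).
have GN : G (N%:Z + 1) = 0.
  by rewrite /G (P_lt0 (k := m - _)) ?(mulr0, mul0r)//; lia.
have G0 : G (- N%:Z) = 0.
  by rewrite /G (P_lt0 (k := _ + _ - 1)) ?(mulr0, mul0r)//; lia.
symmetry; apply: (eq_sum_telescope GN G0) => k; rewrite /G.
have -> : m - 1 - k = m - k - 1 by lia.
have -> : m - 1 + k + 1 = m + k by lia.
have -> : m - (k + 1) = m - k - 1 by lia.
have -> : m + (k + 1) = m + k + 1 by lia.
have -> : k + 1 - N%:Z = k - N%:Z + 1 by lia.
have -> : k + 1 + N%:Z = k + N%:Z + 1 by lia.
have -> : 2 * k + 1 = k + k + 1 by lia.
have -> : (k + 1) * (k + 1) + (k + 1) * N%:Z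
  = k * k + k * N%:Z + k + k + 1 + N%:Z by lia.
have W2 := onem_aq W0 W_pred (m + k + 1).
rewrite [W (k - N%:Z + 1)]W_pred [W (m + k + 1)]W_pred !addrK !P_pred.
have W1 := W0 (m + k).
move: W2; rewrite !expfzDr// -!invr_expz !expr1z => W2.
by field; rewrite !qn0 q0 W1 W2 V0.
Qed.

(* [cs] lists the exponents c for which the successive steps are relative to
   z^2 q^c; its head is the outermost summation, over k_1. *)
Fixpoint chain (N : nat) (cs : seq int) (m : int) : K :=
  if cs is c :: cs' then
    \sum_(k <- zrange N) (z ^+ 2 * q ^ c) ^ k * q ^ (k * k) * P (m - k)
                         * chain N cs' k
  else P (N%:Z + m) / V m.

(** The factor [1 - z^2 q^(2j+1)] of the pair relative to [z^2 q] is kept outside, because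
    [bailey_switch] consumes it. *)
Definition chain_alpha (N p : nat) (j : int) : K :=
  (z ^+ 2 * q) ^ (p%:Z * j) * q ^ (p%:Z * (j * j))
  * (z ^ (j + N%:Z) * q ^ (j * j + j * N%:Z) * W (j - N%:Z) * P (j + N%:Z)
     / V (- N%:Z)).

Lemma chain_nseq1 N p m : - N%:Z <= m <= N%:Z ->
  chain N (nseq p 1) m = \sum_(j <- zrange N)
    chain_alpha N p j * (1 - z ^+ 2 * q ^ (2 * j + 1)) * P (m - j)
    / W (m + j + 1).
Proof.
have zq0 : z ^+ 2 * q != 0 by rewrite mulf_neq0 ?expf_neq0.
have z20 : z ^+ 2 != 0 by rewrite expf_neq0.
elim: p m => [|p IHp] m mN /=.
  rewrite bailey_base//; apply: eq_bigr => j _.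
  by rewrite /chain_alpha !mul0r !expr0z !mul1r.
rewrite (bailey_step z20 W0 W_pred (alpha := fun j =>
  chain_alpha N p j * (1 - z ^+ 2 * q ^ (2 * j + 1))))//;
  last by case/andP: mN.
apply: eq_bigr => j _; rewrite /chain_alpha expr1z.
have -> : p.+1%:Z * j = p%:Z * j + j by lia.
have -> : p.+1%:Z * (j * j) = p%:Z * (j * j) + j * j by lia.
by rewrite !expfzDr//; ring.
Qed.

Lemma chain_closed N p p' m : - N%:Z <= m <= N%:Z ->
  chain N (nseq p' 0 ++ nseq p 1) m = \sum_(j <- zrange N)
    (z ^+ 2) ^ (p'%:Z * j) * q ^ (p'%:Z * (j * j))
    * (chain_alpha N p j - z ^+ 2 * q ^ (2 * j - 1) * chain_alpha N p (j - 1))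
    * P (m - j) / W (m + j).
Proof.
have z20 : z ^+ 2 != 0 by rewrite expf_neq0.
elim: p' m => [|p' IHp] m mN /=.
  rewrite chain_nseq1// (bailey_switch z20 W0 W_pred); last 2 first.
  (* At [j = -N-1] the factor [P (j + N)] is [P (-1) = 0]: the truncation removes the boundary term
     of the switch. *)
  - rewrite /chain_alpha (P_lt0 (k := _ - _ + _)) ?(mulr0, mul0r)//; lia.
  - by case/andP: mN.
  by apply: eq_bigr => j _; rewrite !mul0r !expr0z !mul1r.
rewrite (bailey_step z20 W0 W_pred (alpha := fun j =>
  (z ^+ 2) ^ (p'%:Z * j) * q ^ (p'%:Z * (j * j))
  * (chain_alpha N p j - z ^+ 2 * q ^ (2 * j - 1) * chain_alpha N p (j - 1))));
  last 2 first.
- by move=> k kN; rewrite IHp//; apply: eq_bigr => j _; rewrite addr0.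
- by case/andP: mN.
apply: eq_bigr => j _; rewrite expr0z mulr1 addr0.
have -> : p'.+1%:Z * j = p'%:Z * j + j by lia.
have -> : p'.+1%:Z * (j * j) = p'%:Z * (j * j) + j * j by lia.
by rewrite !expfzDr//; ring.
Qed.

Fixpoint chain_term (N : nat) (cs : seq int) (m : int) (s : seq int) : K :=
  match cs, s with
  | c :: cs', k :: s' => (z ^+ 2 * q ^ c) ^ k * q ^ (k * k) * P (m - k)
                         * chain_term N cs' k s'
  | _, _ => P (N%:Z + m) / V m
  end.

Fixpoint zbox (N n : nat) : seq (seq int) :=
  if n is n'.+1 then [seq k :: s | k <- zrange N, s <- zbox N n']
  else [:: [::]].

Lemma sum_chain_term N cs m :
  \sum_(s <- zbox N (size cs)) chain_term N cs m s = chain N cs m.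
Proof.
elim: cs m => [|c cs IHcs] m; first by rewrite /= big_seq1.
rewrite [size _]/= [zbox _ _]/(allpairs _ _ _) big_allpairs_dep.
by rewrite [RHS]/=; apply: eq_bigr => k _; rewrite /= -mulr_sumr IHcs.
Qed.
End Base.
End BaileyChain.

(** * q-shifted factorials and the finite triple product *)

Definition tri (k : int) : int := ((k * (k - 1)) %/ 2)%Z.

Lemma tri2 (k : int) : 2 * tri k = k * (k - 1).
Proof.
rewrite mulrC divzK//.
have [h [->|->]] : exists h : int, k = h * 2 \/ k = h * 2 + 1.
- exists (k %/ 2)%Z; lia.
- by rewrite -mulrA mulrCA dvdz_mulr.
- by rewrite addrK mulrA dvdz_mull.
Qed.

Lemma triS (k : int) : tri (k + 1) = tri k + k.
Proof. by have := tri2 k; have := tri2 (k + 1); lia. Qed.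

Lemma tri_nat (n : nat) : tri n%:Z = 'C(n, 2)%:Z.
Proof.
elim: n => [|n IHn]; first by [].
by rewrite -addn1 PoszD triS IHn addn1 binS bin1; lia.
Qed.

Section QPoch.
Variables (K : numFieldType) (q : K).
Hypotheses (q0 : q != 0) (q1 : forall n, 1 - q ^+ n.+1 != 0).

Lemma qpoch0 (x : K) : qpoch x q 0 = 1.
Proof. by change (qpoch x q (Posz 0) = 1); rewrite /qpoch big_geq. Qed.

Lemma qpoch_natS (x : K) (n : nat) :
  qpoch x q n.+1 = qpoch x q n * (1 - x * q ^+ n).
Proof. by rewrite /qpoch big_nat_recr. Qed.

(** For [k <= 0] the step cancels an inverted factor, hence a hypothesis at all integer
    exponents. *)
Lemma qpoch_pred (x : K) : (forall e : int, 1 - x * q ^ e != 0) ->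
  forall k, qpoch x q k = qpoch x q (k - 1) * (1 - x * q ^ (k - 1)).
Proof.
move=> x1 [[|n]|n].
- rewrite qpoch0 /qpoch /= big_nat1 mulVf//; exact: (x1 (- 1)).
- have -> : n.+1%:Z - 1 = n%:Z by lia.
  exact: qpoch_natS.
- have -> : Negz n - 1 = Negz n.+1 by lia.
  by rewrite [in RHS]/qpoch big_nat_recr//= divfK//; exact: (x1 (Negz n.+1)).
Qed.

Lemma qpoch_neq0 (x : K) : (forall e : int, 1 - x * q ^ e != 0) ->
  forall k, qpoch x q k != 0.
Proof.
move=> x1 [n|n]; rewrite /qpoch prodf_seq_neq0; apply/allP => j _ /=.
  exact: (x1 j.-1%:Z).
rewrite invr_neq0//; have := x1 (- j%:Z); rewrite -invr_expz; exact.
Qed.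

Lemma qpoch_shift_pred (x : K) : (forall e : int, 1 - x * q ^ e != 0) ->
  forall k, qpoch (x * q) q k = qpoch (x * q) q (k - 1) * (1 - x * q ^ k).
Proof.
move=> x1 k; rewrite qpoch_pred => [|e]; first last.
  by rewrite -mulrA -{1}(expr1z q) -expfzDr.
congr (_ * (1 - _)); rewrite -mulrA; congr (_ * _).
by rewrite -{1}(expr1z q) -expfzDr//; congr (_ ^ _); lia.
Qed.

(** The factor [1 - q q^(-1)] is 0 and so is its inverse by convention; [qpoch q q k] is thus 0
    rather than infinite, and its inverse is the expected value 0 of [1/(q;q)_k]. *)
Lemma qpochq_lt0 (k : int) : k < 0 -> (qpoch q q k)^-1 = 0.
Proof.
case: k => [n|n]; first by lia.
move=> _; rewrite /qpoch big_nat_recl//= expr1 divff// subrr invr0.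
by rewrite mul0r invr0.
Qed.

Lemma qpochq_pred (k : int) :
  (qpoch q q (k - 1))^-1 = (1 - q ^ k) * (qpoch q q k)^-1.
Proof.
case: k => [[|n]|n].
- by rewrite qpochq_lt0// expr0z subrr mul0r.
- have -> : n.+1%:Z - 1 = n%:Z by lia.
  by rewrite qpoch_natS -exprS invfM mulrCA -exprnP mulfV ?mulr1 ?q1.
- by rewrite !qpochq_lt0 ?mulr0//; lia.
Qed.

(** Reversal of the product. It produces the symbols in [1/z] and [1/z^2] of the right-hand side and
    governs the growth of [1/(zq;q)_k] at negative [k]. *)
Lemma qpoch_opp (x : K) (n : nat) : x != 0 ->
  (forall e : int, 1 - x * q ^ e != 0) ->
  qpoch (x * q) q (- n%:Z)
  = (- x) ^ (- n%:Z) * q ^ tri n%:Z / qpoch x^-1 q n%:Z.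
Proof.
move=> x0 x1; elim: n => [|n IHn].
  by rewrite oppr0 !qpoch0 divr1 !expr0z mulr1.
have e1 : 1 - x * q ^ (- n%:Z) = - x * q ^ (- n%:Z) * (1 - x^-1 * q ^+ n).
  rewrite -invr_expz; have : q ^ n%:Z != 0 by rewrite expfz_neq0.
  rewrite -exprnP => qn0; field; by rewrite x0 qn0.
have := x1 (- n%:Z); rewrite e1 !mulf_eq0 !negb_or => /andP[/andP[x0' qn0] nz].
apply: (mulIf (x1 (- n%:Z))).
have -> : - n.+1%:Z = - n%:Z - 1 by lia.
rewrite -qpoch_shift_pred// IHn e1 qpoch_natS.
rewrite -[n.+1]addn1 PoszD triS !expfzDr// -![q ^ (- _)]invr_expz.
have qn0' : q ^ n%:Z != 0 by rewrite expfz_neq0.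
have -> : (- x) ^ (- 1) = (- x)^-1 by [].
have [->|pn0] := eqVneq (qpoch x^-1 q n) 0.
  by rewrite mul0r !invr0 !mulr0 mul0r.
move: nz qn0'; rewrite -exprnP => nz qn0'.
field; rewrite pn0 x0 qn0' /= andbT.
have -> : x - q ^+ n = x * (1 - x^-1 * q ^+ n) by field; rewrite x0.
by rewrite mulf_neq0.
Qed.
End QPoch.

(** * The finite form of Jacobi's triple product *)

Section FiniteTripleProduct.
Variables (K : fieldType) (q x : K) (P : int -> K).
Hypotheses (q0 : q != 0) (x0 : x != 0).
Hypothesis P_lt0 : forall k : int, k < 0 -> P k = 0.
Hypothesis P_pred : forall k : int, P (k - 1) = (1 - q ^ k) * P k.

Definition theta (j : int) : K := (- x) ^ j * q ^ tri j.

Lemma thetaS j : theta (j + 1) = - x * q ^ j * theta j.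
Proof.
by rewrite /theta triS !expfzDr ?oppr_eq0// expr1z; ring.
Qed.

(** Independent cutoffs [A] and [B] let an induction add one factor of [(q/x)_A] or [(x)_B] at a
    time; [N] only fixes a common range. *)
Definition tp_sum N A B :=
  \sum_(k <- zrange N) theta k * P (A%:Z + k) * P (B%:Z - k).

Lemma tp_sum_stepB N A B : (A <= N)%N -> (B < N)%N ->
  tp_sum N A B.+1 * (1 - q ^+ (A + B.+1)) = (1 - x * q ^+ B) * tp_sum N A B.
Proof.
move=> AN BN; rewrite /tp_sum mulr_suml mulr_sumr.
(* From [1 - q^(A+B+1) = (1 - q^(B+1-k)) + q^(B+1-k) (1 - q^(A+k))]: the first part gives the sum
   for [B], the second, shifted by one in [k], gives [-x q^B] times that sum. *)
pose G k := - q ^ (B.+1%:Z - k) * theta k * P (A%:Z + k - 1) * P (B.+1%:Z - k).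
have GN : G (N%:Z + 1) = 0.
  by rewrite /G (P_lt0 (k := _.+1%:Z - _)) ?mulr0 ?mul0r//; lia.
have G0 : G (- N%:Z) = 0.
  by rewrite /G (P_lt0 (k := _ - _ - 1)) ?mulr0 ?mul0r//; lia.
apply: (eq_sum_telescope GN G0) => k; rewrite /G.
have -> : A%:Z + (k + 1) - 1 = A%:Z + k by lia.
have -> : B.+1%:Z - (k + 1) = B%:Z - k by lia.
have -> : B%:Z - k = B.+1%:Z - k - 1 by lia.
rewrite !P_pred thetaS !exprnP PoszD.
have -> : B.+1%:Z - k - 1 = B%:Z - k by lia.
have -> : B.+1%:Z = B%:Z + 1 by lia.
have qn0 m : q ^ m != 0 by rewrite expfz_neq0.
by rewrite !expfzDr// -!invr_expz !expr1z; field; rewrite !qn0.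
Qed.

Lemma tp_sum_stepA N A B : (A < N)%N -> (B <= N)%N ->
  tp_sum N A.+1 B * (1 - q ^+ (A.+1 + B)) = (1 - q / x * q ^+ A) * tp_sum N A B.
Proof.
move=> AN BN; rewrite /tp_sum mulr_suml mulr_sumr.
(* The mirror splitting, [1 - q^(A+B+1) = (1 - q^(A+1+k)) + q^(A+1+k) (1 - q^(B-k))]. *)
pose G k := - q ^ A.+1%:Z / x * theta k * P (A.+1%:Z + k - 1) * P (B%:Z - k).
have GN : G (N%:Z + 1) = 0.
  by rewrite /G (P_lt0 (k := B%:Z - _)) ?mulr0 ?mul0r//; lia.
have G0 : G (- N%:Z) = 0.
  by rewrite /G (P_lt0 (k := _ - _ - 1)) ?mulr0 ?mul0r//; lia.
apply: (eq_sum_telescope GN G0) => k; rewrite /G.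
have -> : A.+1%:Z + (k + 1) - 1 = A.+1%:Z + k by lia.
have -> : B%:Z - (k + 1) = B%:Z - k - 1 by lia.
have -> : A%:Z + k = A.+1%:Z + k - 1 by lia.
rewrite !P_pred thetaS !exprnP PoszD.
have -> : A.+1%:Z = A%:Z + 1 by lia.
have qn0 m : q ^ m != 0 by rewrite expfz_neq0.
by rewrite !expfzDr// -!invr_expz !expr1z; field; rewrite !qn0 x0.
Qed.
End FiniteTripleProduct.

Lemma finite_triple_product (K : numFieldType) (q x : K) N :
  q != 0 -> x != 0 -> (forall n, 1 - q ^+ n.+1 != 0) ->
  qpoch x q N%:Z * qpoch (q / x) q N%:Z / qpoch q q (N + N)%:Z
  = \sum_(j <- zrange N)
      theta q x j / qpoch q q (N%:Z + j) / qpoch q q (N%:Z - j).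
Proof.
move=> q0 x0 q1; pose P k := (qpoch q q k)^-1.
have P0 : P 0 = 1 by rewrite /P qpoch0 invr1.
have P_lt0 := qpochq_lt0 q0 : forall k : int, k < 0 -> P k = 0.
have P_pred := qpochq_pred q0 q1 :
  forall k : int, P (k - 1) = (1 - q ^ k) * P k.
have PS n : P n.+1%:Z * (1 - q ^+ n.+1) = P n%:Z.
  by rewrite mulrC exprnP -P_pred; congr P; lia.
suff H A B : (A <= N)%N -> (B <= N)%N -> tp_sum q x P N A B
    = qpoch x q B%:Z * qpoch (q / x) q A%:Z * P (A + B)%:Z.
  by rewrite -/(P _) -H.
elim: A B => [|A IHA].
  elim=> [_ _|B IHB AN BN].
    rewrite !qpoch0 P0 /tp_sum (big_zrange_single (j := 0)); last 2 first.
    - by lia.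
    - move=> k k0; have [kneg|kpos] := ltP k 0.
        by rewrite (P_lt0 (0%:Z + k)) ?mulr0 ?mul0r//; lia.
      by rewrite (P_lt0 (0%:Z - k)) ?mulr0//; lia.
    by rewrite addr0 P0 /theta !expr0z !mulr1.
  have := tp_sum_stepB q0 x0 P_lt0 P_pred AN BN; rewrite !add0n => step.
  apply: (mulIf (q1 B)); rewrite step (IHB AN (ltnW BN)) qpoch_natS add0n -PS.
  by ring.
move=> B AN BN; rewrite addSn; apply: (mulIf (q1 (A + B)%N)).
rewrite -[in LHS]addSn tp_sum_stepA// (IHA _ (ltnW AN) BN) qpoch_natS -PS.
by ring.
Qed.

(** * The truncated chain as two theta sums *)

Section ClosedForm.
Variables (K : numFieldType) (q z : K).
Hypotheses (q0 : q != 0) (q1 : forall n, 1 - q ^+ n.+1 != 0) (z0 : z != 0).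
Hypothesis z21 : forall e : int, 1 - z ^+ 2 * q ^ e != 0.

Lemma onem_zq (e : int) : 1 - z * q ^ e != 0.
Proof.
apply: contra (z21 (e + e)); rewrite !subr_eq0 => /eqP ze.
by rewrite expfzDr// expr2 mulrACA -ze mulr1.
Qed.

Lemma qpoch_inv_neq0 (x : K) : x != 0 -> (forall e : int, 1 - x * q ^ e != 0) ->
  forall k, qpoch x^-1 q k != 0.
Proof.
move=> x0 x1; apply: qpoch_neq0 => // e; apply: contra (x1 (- e)).
rewrite !subr_eq0 => /eqP e1.
have qe0 : q ^ e != 0 by rewrite expfz_neq0.
by rewrite -invr_expz -[x]invrK -invfM -e1 invr1.
Qed.

Let P k := (qpoch q q k)^-1.
Let V := qpoch (z * q) q.
Let W := qpoch (z ^+ 2 * q) q.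

(** Signed monomials encoded by their exponents, so that the theta identities below become
    identities between integers. *)
Let mono (e f g : int) : K := (-1) ^ e * z ^ f * q ^ g.

Let N10 : -1 != 0 :> K. Proof. by rewrite oppr_eq0 oner_eq0. Qed.

Let monoM e f g e' f' g' :
  mono e f g * mono e' f' g' = mono (e + e') (f + f') (g + g').
Proof. by rewrite /mono !expfzDr//; ring. Qed.

Let monoV e f g : (mono e f g)^-1 = mono (- e) (- f) (- g).
Proof. by rewrite /mono !invfM !invr_expz. Qed.

Let mono_z f : z ^ f = mono 0 f 0.
Proof. by rewrite /mono !expr0z mul1r mulr1. Qed.

Let mono_q g : q ^ g = mono 0 0 g.
Proof. by rewrite /mono !expr0z mul1r mul1r. Qed.

Let mono_Nz k : (- z) ^ k = mono k k 0.
Proof. by rewrite /mono expNrz expr0z mulr1. Qed.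

Let mono_z2 k : (z ^+ 2) ^ k = mono 0 (2 * k) 0.
Proof. by rewrite /mono exprnP exprz_exp !expr0z mul1r mulr1. Qed.

Let mono_Nz2 k : (- z ^+ 2) ^ k = mono k (2 * k) 0.
Proof. by rewrite expNrz exprnP exprz_exp /mono expr0z mulr1. Qed.

Let mono_z2q k : (z ^+ 2 * q) ^ k = mono 0 (2 * k) k.
Proof. by rewrite expfzMl mono_z2 mono_q monoM !addr0 add0r. Qed.

Let mono_theta (r c : nat) j : theta (q ^+ r) (z ^+ r * q ^+ c) j
  = mono j (r%:Z * j) (c%:Z * j + r%:Z * tri j).
Proof.
by rewrite /theta expNrz expfzMl !exprnP !exprz_exp /mono expfzDr//; ring.
Qed.

(** The dependence on [N] cancels: [tri (N - j) - tri N = -N j + (j^2 + j)/2], which absorbs the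
    factor [q^(j N)] of the initial pair. *)
Lemma theta_monomial1 (r i N n : nat) (j : int) :
  (1 <= i <= r)%N -> j = N%:Z - n%:Z ->
  (z ^+ 2) ^ (i.-1%:Z * j) * q ^ (i.-1%:Z * (j * j))
  * ((z ^+ 2 * q) ^ ((r - i)%:Z * j) * q ^ ((r - i)%:Z * (j * j))
     * (z ^ (j + N%:Z) * q ^ (j * j + j * N%:Z)))
  * ((- z ^+ 2) ^ (- n%:Z) * q ^ tri n%:Z) / ((- z) ^ (- N%:Z) * q ^ tri N%:Z)
  = theta (q ^+ (2 * r + 1)) (z ^+ (2 * r + 1) * q ^+ (2 * r + 1 - i)) j.
Proof.
move=> ir jE.
rewrite mono_theta mono_z2 mono_z2q mono_z mono_Nz mono_Nz2 !mono_q.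
rewrite !monoM monoV monoM.
have tn := tri2 n%:Z; have tN := tri2 N%:Z; have tj := tri2 j.
have rtj : 2 * (r%:Z * tri j) = r%:Z * (j * (j - 1)) by rewrite -tj; ring.
have -> : i.-1%:Z = i%:Z - 1 by lia.
have -> : (r - i)%:Z = r%:Z - i%:Z by lia.
have -> : (2 * r + 1 - i)%N%:Z = 2 * r%:Z + 1 - i%:Z by lia.
have nE : n%:Z = N%:Z - j by lia.
rewrite nE in tn *.
congr mono; lia.
Qed.

(** Same cancellation for the subtracted [alpha_(j-1)], where [n + 1 = N - (j - 1)]; the shift by
    one leaves the constant power of [z] in front of the second theta series. *)
Lemma theta_monomial2 (r i N n : nat) (j : int) :
  (1 <= i <= r)%N -> j = N%:Z - n%:Z ->
  - ((z ^+ 2) ^ (i.-1%:Z * j) * q ^ (i.-1%:Z * (j * j))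
  * (z ^+ 2 * q ^ (2 * j - 1))
  * ((z ^+ 2 * q) ^ ((r - i)%:Z * (j - 1))
     * q ^ ((r - i)%:Z * ((j - 1) * (j - 1)))
     * (z ^ (j - 1 + N%:Z) * q ^ ((j - 1) * (j - 1) + (j - 1) * N%:Z)))
  * ((- z ^+ 2) ^ (- n.+1%:Z) * q ^ tri n.+1%:Z)
  / ((- z) ^ (- N%:Z) * q ^ tri N%:Z))
  = z ^ (2 * i%:Z - 1 - 2 * r%:Z)
    * theta (q ^+ (2 * r + 1)) (z ^+ (2 * r + 1) * q ^+ i) j.
Proof.
move=> ir jE.
rewrite mono_theta mono_z2 mono_z2q !mono_z mono_Nz mono_Nz2 !mono_q.
rewrite -[LHS]mulN1r.
have -> : z ^+ 2 = mono 0 2 0 by rewrite exprnP mono_z.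
have -> : (-1 : K) = mono 1 0 0 by rewrite /mono !expr0z !mulr1 expr1z.
rewrite !monoM monoV !monoM.
have tn := tri2 n.+1%:Z; have tN := tri2 N%:Z; have tj := tri2 j.
have rtj : 2 * (r%:Z * tri j) = r%:Z * (j * (j - 1)) by rewrite -tj; ring.
have -> : i.-1%:Z = i%:Z - 1 by lia.
have -> : (r - i)%:Z = r%:Z - i%:Z by lia.
have nE : n.+1%:Z = N%:Z - j + 1 by lia.
rewrite nE in tn *.
congr mono; lia.
Qed.

(** Reversing [V (-N)] and [W (j - N)] separates each term into a theta monomial free of [N] and a
    weight that is bounded and converges as [N] grows. *)
Lemma chain_closed_theta (r i N : nat) : (1 <= i <= r)%N ->
  chain q P z V N (nseq i.-1 0 ++ nseq (r - i) 1) N%:Z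
  = qpoch z^-1 q N%:Z *
    (\sum_(j <- zrange N)
       theta (q ^+ (2 * r + 1)) (z ^+ (2 * r + 1) * q ^+ (2 * r + 1 - i)) j
       * (P (N%:Z + j) * P (N%:Z - j)
          / qpoch (z ^+ 2)^-1 q (N%:Z - j) / W (N%:Z + j))
     + z ^ (2 * i%:Z - 1 - 2 * r%:Z)
       * \sum_(j <- zrange N)
       theta (q ^+ (2 * r + 1)) (z ^+ (2 * r + 1) * q ^+ i) j
       * (P (N%:Z + j - 1) * P (N%:Z - j)
          / qpoch (z ^+ 2)^-1 q (N%:Z - j + 1) / W (N%:Z + j))).
Proof.
move=> ir; have z20 : z ^+ 2 != 0 by rewrite expf_neq0.
have zn0 := onem_zq.
have W0 : forall k, W k != 0.
  apply: qpoch_neq0 => // e; have := z21 (1 + e).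
  by rewrite expfzDr// expr1z mulrA.
have V0 : forall k, V k != 0.
  apply: qpoch_neq0 => // e; have := zn0 (1 + e).
  by rewrite expfzDr// expr1z mulrA.
have U0 := qpoch_inv_neq0 z20 z21; have Y0 := qpoch_inv_neq0 z0 zn0.
have P0 : P 0 = 1 by rewrite /P qpoch0 invr1.
rewrite (chain_closed q0 q1 P0 (qpochq_lt0 q0) (qpochq_pred q0 q1) z0 V0 W0
  (qpoch_shift_pred q0 zn0) (qpoch_shift_pred q0 z21)); last by lia.
rewrite mulrDr mulrCA !mulr_sumr -big_split /=.
rewrite big_seq_cond [RHS]big_seq_cond; apply: eq_bigr => j.
rewrite andbT mem_zrange => jN.
have [n jE] : exists n : nat, j = N%:Z - n%:Z by exists (absz (N%:Z - j)); lia.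
rewrite [z ^ _ * (_ * _)]mulrCA [z ^ _ * (_ * _)]mulrA.
rewrite -(theta_monomial1 ir jE) -(theta_monomial2 ir jE) /chain_alpha.
have -> : j - N%:Z = - n%:Z by lia.
have -> : j - 1 - N%:Z = - n.+1%:Z by lia.
have -> : N%:Z - j + 1 = n.+1%:Z by lia.
have -> : N%:Z - j = n%:Z by lia.
have -> : N%:Z + j - 1 = j - 1 + N%:Z by lia.
have -> : N%:Z + j = j + N%:Z by lia.
rewrite /W /V !qpoch_opp// -!/(W _).
have zN0 : (- z) ^ (- N%:Z) != 0 by rewrite expfz_neq0// oppr_eq0.
have qN0 : q ^ tri N%:Z != 0 by rewrite expfz_neq0.
have U1 := U0 n%:Z; have U2 := U0 n.+1%:Z; have Y1 := Y0 N%:Z.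
have W1 := W0 (j + N%:Z).
set z2n := (- z ^+ 2) ^ (- n%:Z); set z2n1 := (- z ^+ 2) ^ (- n.+1%:Z).
move: (W (j + N%:Z)) (qpoch _ q n%:Z) (qpoch _ q n.+1%:Z) (qpoch z^-1 q N%:Z)
  ((- z) ^ (- N%:Z)) (q ^ tri N%:Z) W1 U1 U2 Y1 zN0 qN0.
move=> w u u' y zN qN w0 u0 u'0 y0 zN0 qN0.
move: z2n z2n1 => z2n z2n1.
by field; rewrite w0 u0 u'0 y0 zN0 qN0.
Qed.

Lemma chain_termE N cs m s : size s = size cs ->
  chain_term q P z V N cs m s
  = (\prod_(0 <= j < size s) ((z ^+ 2 * q ^ cs`_j) ^ s`_j * q ^ (s`_j * s`_j)))
    * (\prod_(0 <= j < size s) P ((m :: s)`_j - s`_j))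
    * P (N%:Z + last m s) / V (last m s).
Proof.
elim: cs m s => [|c cs IHcs] m [|k s] //= => [_|[ss]].
  by rewrite !big_geq// !mul1r.
by rewrite IHcs// !big_nat_recl//=; ring.
Qed.

End ClosedForm.

(** * Nonincreasing sequences of integers *)

Definition lambda_seq n (k : Lambda n) : seq int := tval (sval k).

Definition lambda_of_seq n (s : seq int) : option (Lambda n) :=
  obind insub (insub s : option (n.-tuple int)).

Lemma lambda_seqK n : pcancel (@lambda_seq n) (@lambda_of_seq n).
Proof. by move=> k; rewrite /lambda_of_seq /lambda_seq valK /= valK. Qed.

Lemma lambda_of_seqK n : ocancel (@lambda_of_seq n) (@lambda_seq n).
Proof.
move=> s; rewrite /lambda_of_seq; case: insubP => //= t _ <-.
by case: insubP => //= k _ <-.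
Qed.

Lemma size_lambda_seq n (k : Lambda n) : size (lambda_seq k) = n.
Proof. exact: size_tuple. Qed.

Lemma lambda_of_seq_None n (s : seq int) :
  size s = n -> lambda_of_seq n s = None -> ~~ sorted >=%R s.
Proof.
move=> sn; rewrite /lambda_of_seq; case: insubP => [t _ <-|];
  last by rewrite sn eqxx.
by rewrite /=; case: insubP.
Qed.

Lemma mem_zbox N n s :
  (s \in zbox N n) = (size s == n) && all (mem (zrange N)) s.
Proof.
elim: n s => [|n IHn] s; first by rewrite inE; case: s.
apply/allpairsP/idP => [[[k t] /= [kN]]|].
  by rewrite IHn => /andP[/eqP <- tN] -> /=; rewrite eqxx /= kN.
case: s => // k t /= /andP[tn /andP[kN tN]]; exists (k, t).
by rewrite /= IHn -eqSS tn tN.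
Qed.

Lemma uniq_zbox N n : uniq (zbox N n).
Proof.
elim: n => // n IHn.
apply: allpairs_uniq => //; first exact: uniq_zrange.
by move=> [? ?] [? ?] _ _ /= [-> ->].
Qed.

Lemma prod_expz (K : fieldType) (x : K) (I : Type) (s : seq I) (F : I -> int) :
  x != 0 -> \prod_(j <- s) x ^ F j = x ^ (\sum_(j <- s) F j).
Proof.
by move=> x0; elim/big_rec2: _ => [|j a b _ ->]; rewrite ?expr0z// expfzDr.
Qed.

Lemma chain_term_unsorted (K : fieldType) (q z : K) (P V : int -> K) N cs m s :
  (forall k : int, k < 0 -> P k = 0) ->
  size s = size cs -> ~~ path >=%R m s -> chain_term q P z V N cs m s = 0.
Proof.
move=> P_lt0; elim: cs m s => [|c cs IHcs] m [|k s] //= [ss].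
rewrite negb_and => /orP[|/IHcs->//]; last by rewrite mulr0.
by rewrite -ltNge => mk; rewrite P_lt0 ?(mulr0, mul0r)//; lia.
Qed.

(** A step relative to [z^2 q] contributes an extra [q^(k_j)], so the ones stand at the positions
    [j >= i] of the linear exponent. *)
Definition shifts (r i : nat) : seq int := nseq i.-1 0 ++ nseq (r - i) 1.

Lemma size_shifts r i : (1 <= i <= r)%N -> size (shifts r i) = r.-1.
Proof. by move=> hi; rewrite size_cat !size_nseq; lia. Qed.

Lemma nth_shifts r i j : (1 <= i <= r)%N -> (j < r.-1)%N ->
  (shifts r i)`_j = ((i <= j.+1)%N : nat)%:Z.
Proof.
move=> hi jr; rewrite nth_cat size_nseq !nth_nseq.
have [ij|ij] := ltnP j i.-1; first by have -> : (i <= j.+1)%N = false by lia.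
have -> : (j - i.-1 < r - i)%N by lia.
by have -> : (i <= j.+1)%N by lia.
Qed.

(** * The summand and its truncation *)

Section Summand.
Variables (K : numFieldType) (r i : nat) (q z : K).
Hypotheses (hr : (2 <= r)%N) (hi : (1 <= i <= r)%N).
Hypotheses (q0 : q != 0) (z0 : z != 0).

Definition summand (k : Lambda r.-1) : K :=
  q ^ (\sum_(1 <= j < r) entry k j ^+ 2 + \sum_(i <= j < r) entry k j)
    * z ^ (2 * \sum_(1 <= j < r) entry k j)
  / (qpoch (z * q) q (entry k r.-1)
       * \prod_(1 <= j < r.-1) qpoch q q (entry k j - entry k j.+1)).

Lemma summandE (k : Lambda r.-1) (s := lambda_seq k) :
  summand k
  = (\prod_(0 <= j < r.-1)
       ((z ^+ 2 * q ^ (shifts r i)`_j) ^ s`_j * q ^ (s`_j * s`_j)))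
    * (\prod_(1 <= j < r.-1) (qpoch q q (s`_j.-1 - s`_j))^-1)
    / qpoch (z * q) q (last 0 s).
Proof.
have entryE j : entry k j = s`_j.-1 by [].
rewrite /summand invfM [in RHS]prodfV.
have -> : entry k r.-1 = last 0 s.
  by rewrite entryE -nth_last size_lambda_seq.
rewrite [X in _ = X * _ / _](_ : _
    = q ^ (\sum_(1 <= j < r) entry k j ^+ 2 + \sum_(i <= j < r) entry k j)
    * z ^ (2 * \sum_(1 <= j < r) entry k j));
  first by rewrite [LHS]mulrA [LHS]mulrAC.
have -> : \sum_(i <= j < r) entry k j
    = \sum_(0 <= j < r.-1) (shifts r i)`_j * s`_j.
  rewrite [RHS](big_cat_nat _ (n := i.-1)) //=; [|lia].
  have -> : \sum_(0 <= j < i.-1) (shifts r i)`_j * s`_j = 0.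
    rewrite big_nat_cond big1// => j /andP[/andP[_ ji] _].
    rewrite nth_shifts//; last by lia.
    have -> : (i <= j.+1)%N = false by lia.
    by rewrite mul0r.
  rewrite add0r.
  have iE : i = i.-1.+1 by lia.
  rewrite [in LHS]iE big_add1 big_nat_cond [RHS]big_nat_cond.
  apply: eq_bigr => j /andP[/andP[ij jr] _]; rewrite nth_shifts//.
  have -> : (i <= j.+1)%N by lia.
  by rewrite mul1r.
rewrite !big_add1.
rewrite big_split /= prod_expz// expfzDr//.
under eq_bigr do rewrite expfzMl exprz_exp exprnP exprz_exp.
rewrite big_split /= !prod_expz// -mulr_sumr.
have -> : \sum_(0 <= j < r.-1) entry k j.+1 ^+ 2
    = \sum_(0 <= j < r.-1) s`_j * s`_j.
  by apply: eq_bigr => j _; rewrite entryE expr2.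
have -> : \sum_(0 <= j < r.-1) entry k j.+1 = \sum_(0 <= j < r.-1) s`_j by [].
by ring.
Qed.

Lemma chain_term_summand (k : Lambda r.-1) (N : nat)
    (P := fun j => (qpoch q q j)^-1) :
  chain_term q P z (qpoch (z * q) q) N (shifts r i) N%:Z (lambda_seq k)
  = summand k * (P (N%:Z - entry k 1) * P (N%:Z + entry k r.-1)).
Proof.
have lastE : last N%:Z (lambda_seq k) = entry k r.-1.
  rewrite /entry -[(_ `_ _)](_ : last 0 (lambda_seq k) = _); last first.
    by rewrite -nth_last size_lambda_seq.
  by have := size_lambda_seq k; case: (lambda_seq k) => //=; lia.
rewrite chain_termE ?size_shifts ?size_lambda_seq// summandE lastE.
have -> : last 0 (lambda_seq k) = entry k r.-1.
  by rewrite -nth_last size_lambda_seq.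
(* The factor [j = 0] is the truncating [P (N - k_1)]; the others are the denominators of the
   summand. *)
rewrite [X in _ * X * _ * _]big_ltn; last by lia.
rewrite [X in _ * (_ * X) * _ * _](_ : _
   = \prod_(1 <= j < r.-1)
       (qpoch q q ((lambda_seq k)`_j.-1 - (lambda_seq k)`_j))^-1).
  by rewrite /P /=; ring.
by rewrite big_nat_cond [RHS]big_nat_cond; apply: eq_bigr => -[].
Qed.
End Summand.

Local Open Scope classical_set_scope.
Local Open Scope complex_scope.

(** * Dominated convergence *)

Lemma sum_subset_split (V : zmodType) (I : eqType) (f : I -> V) (B Y : seq I) :
  uniq B -> uniq Y -> {subset Y <= B} ->
  \sum_(k <- B) f k
  = \sum_(k <- Y) f k + \sum_(k <- [seq k <- B | k \notin Y]) f k.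
Proof.
move=> uB uY YB; rewrite (bigID (mem Y)) /= big_filter; congr (_ + _).
rewrite -big_filter; apply: perm_big; apply: uniq_perm; rewrite ?filter_uniq//.
move=> k; rewrite mem_filter; apply/andP/idP => [[]//|kY].
by split=> //; exact: YB.
Qed.

Section Tannery.
Variables (K : numFieldType) (I : choiceType).
Implicit Types (f g : I -> K) (X : nat -> seq I).

(** Summability in Cauchy form, which names no limit and asks no completeness of [K]. *)
Definition small_tails g := forall e : K, 0 < e ->
  exists2 Y : seq I, uniq Y &
  forall B, uniq B -> {in B, forall k, k \notin Y} -> \sum_(k <- B) g k <= e.

Lemma near_subset X (Y : seq I) :
  (forall k, \forall N \near \oo, k \in X N) ->
  \forall N \near \oo, {subset Y <= X N}.
Proof.
move=> hX; elim: Y => [|k Y IHY]; first by near=> N.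
near=> N => l; rewrite inE => /predU1P[->|]; first by near: N; exact: hX.
by move: l; near: N.
Unshelve. all: by end_near. Qed.

Lemma cvg_sum_seq (F : nat -> I -> K) f (Y : seq I) :
  (forall k, F N k @[N --> \oo] --> f k) ->
  \sum_(k <- Y) F N k @[N --> \oo] --> \sum_(k <- Y) f k.
Proof.
move=> Ff; elim: Y => [|k Y IHY].
  by rewrite big_nil; under eq_fun do rewrite big_nil; exact: cvg_cst.
rewrite big_cons; under eq_fun do rewrite big_cons.
exact: cvgD (Ff k) IHY.
Qed.

(** On [Y] the terms converge pointwise; off [Y] both sums are tails of [g]. Leaving [B] free serves
    two purposes: any large finite set for [has_sum], and [B = X N] for [tannery_cvg]. *)
Lemma tannery f g (F : nat -> I -> K) X :
  (forall N, uniq (X N)) -> (forall k, \forall N \near \oo, k \in X N) ->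
  (forall k, F N k @[N --> \oo] --> f k) ->
  (forall N k, k \in X N -> `|F N k| <= g k) -> (forall k, `|f k| <= g k) ->
  small_tails g ->
  forall e : K, 0 < e -> exists2 Y : seq I, uniq Y &
  \forall N \near \oo, forall B, uniq B -> {subset Y <= B} ->
  `|\sum_(k <- B) f k - \sum_(k <- X N) F N k| <= e.
Proof.
move=> uX hX Ff Fg fg tails e e0.
have e3 : 0 < e / 3 by rewrite divr_gt0.
have [Y uY YP] := tails _ e3; exists Y => //.
have YX := near_subset Y hX.
have sY := cvg_sum_seq (Y := Y) Ff.
have {}sY : \forall N \near \oo,
    `|\sum_(k <- Y) f k - \sum_(k <- Y) F N k| <= e / 3.
  by move/cvgrPdist_le : sY; apply.
near=> N => B uB YB.
rewrite (sum_subset_split f uB uY YB).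
rewrite (sum_subset_split (F N) (uX N) uY); last by near: N.
rewrite (_ : e = e / 3 + e / 3 + e / 3); last by field.
rewrite opprD addrACA addrA.
apply: (le_trans (ler_normB _ _)); apply: lerD.
  apply: (le_trans (ler_normD _ _)); apply: lerD; first by near: N.
  apply: (le_trans (ler_norm_sum _ _ _)).
  apply: le_trans (YP [seq k <- B | k \notin Y] _ _); rewrite ?filter_uniq//.
    exact: ler_sum.
  by move=> k; rewrite mem_filter => /andP[].
apply: (le_trans (ler_norm_sum _ _ _)).
apply: le_trans (YP [seq k <- X N | k \notin Y] _ _); rewrite ?filter_uniq//.
  rewrite big_seq_cond [leRHS]big_seq_cond; apply: ler_sum => k.
  by rewrite andbT mem_filter => /andP[_]; exact: Fg.
by move=> k; rewrite mem_filter => /andP[].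
Unshelve. all: by end_near. Qed.

Lemma tannery_has_sum f g (F : nat -> I -> K) X (s : K) :
  (forall N, uniq (X N)) -> (forall k, \forall N \near \oo, k \in X N) ->
  (forall k, F N k @[N --> \oo] --> f k) ->
  (forall N k, k \in X N -> `|F N k| <= g k) -> (forall k, `|f k| <= g k) ->
  small_tails g ->
  \sum_(k <- X N) F N k @[N --> \oo] --> s -> has_sum f s.
Proof.
move=> uX hX Ff Fg fg tails Fs; have tF := @summability.totally_filter I.
apply/cvgrPdist_le => e e0; have e2 : 0 < e / 2 by rewrite divr_gt0.
have [Y uY YP] := tannery uX hX Ff Fg fg tails e2.
move/cvgrPdist_le : Fs => /(_ _ e2) Fs.
exists [fset k in Y]%fset => // B /= YB.
rewrite /summability.partial_sum -(big_seq_fsetE _ _ predT) /=.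
near \oo => N.
rewrite (_ : e = e / 2 + e / 2); last by field.
rewrite (_ : s - _ = (s - \sum_(k <- X N) F N k)
   - (\sum_(k <- B) f k - \sum_(k <- X N) F N k)); last by ring.
apply: (le_trans (ler_normB _ _)); apply: lerD; first by near: N.
have := near YP N; apply => //.
by move=> k kY; apply: (fsubsetP YB); rewrite inE.
Unshelve. all: by end_near. Qed.

Lemma tannery_cvg f g (F : nat -> I -> K) X :
  (forall N, uniq (X N)) -> (forall k, \forall N \near \oo, k \in X N) ->
  (forall k, F N k @[N --> \oo] --> f k) ->
  (forall N k, k \in X N -> `|F N k| <= g k) -> (forall k, `|f k| <= g k) ->
  small_tails g ->
  \sum_(k <- X N) f k - \sum_(k <- X N) F N k @[N --> \oo] --> 0.
Proof.
move=> uX hX Ff Fg fg tails.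
apply/cvgr0Pnorm_le => e e0.
have [Y uY YP] := tannery uX hX Ff Fg fg tails e0.
have YX := near_subset Y hX.
near=> N; have := near YP N; apply => //; by near: N.
Unshelve. all: by end_near. Qed.
End Tannery.

(** * Infinite products in the complex numbers *)

Lemma cvg_seq_le_bound (K : numFieldType) (u : nat -> K) (l : K) :
  u n @[n --> \oo] --> l -> exists2 M, 0 < M & forall n, `|u n| <= M.
Proof.
move=> ul; have cu : cvgn u by apply/cvg_ex; exists l.
have [M [Mr MP]] := cvg_seq_bounded cu.
have M1 : M < `|M| + 1.
  by apply: le_lt_trans (real_ler_norm Mr) _; rewrite ltrDl.
exists (`|M| + 1) => [|n]; first by rewrite ltr_wpDl.
by apply: (MP _ M1).
Qed.

Lemma qpoch_natE (K : numFieldType) (x q : K) (n : nat) :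
  qpoch x q n%:Z = \prod_(0 <= j < n) (1 - x * q ^+ j).
Proof. by rewrite /qpoch big_add1. Qed.

(* The topology of a numFieldType is keyed on its coercion to Type, so the
   literal carrier [R[i]] does not carry it, but [complexField R] does. *)
Definition complexField (R : realType) : numFieldType := R[i].

Section ComplexLimits.
Variable R : realType.
Local Notation C := (complexField R).
Implicit Types (u : nat -> C) (x q : C).

Lemma normcRe x : `|x| = (complex.Re `|x|)%:C.
Proof. by rewrite RRe_real// normr_real. Qed.

Lemma ReNorm_ge0 x : 0 <= complex.Re `|x|.
Proof. by rewrite -lecR -normcRe; exact: normr_ge0. Qed.

Lemma cvgC_dominated u (l : C) (v : nat -> R) :
  (forall n, `|u n - l| <= (v n)%:C) -> v n @[n --> \oo] --> (0 : R) ->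
  u n @[n --> \oo] --> l.
Proof.
move=> uv v0; apply/cvgrPdist_le => e e0.
have eE : e = (complex.Re e)%:C by rewrite RRe_real// gtr0_real.
have e'0 : 0 < complex.Re e by rewrite -ltcR -eE.
move/cvgr0Pnorm_le : v0 => /(_ _ e'0) v0.
near=> n; rewrite distrC; apply: le_trans (uv n) _; rewrite eE lecR.
by apply: le_trans (ler_norm _) _; near: n.
Unshelve. all: by end_near. Qed.

Lemma cvg_expC q : `|q| < 1 -> q ^+ n @[n --> \oo] --> (0 : C).
Proof.
move=> q1; apply: (@cvgC_dominated _ _ (fun n => complex.Re `|q| ^+ n)).
  by move=> n; rewrite subr0 normrX normcRe rmorphXn.
by apply: cvg_expr; rewrite ger0_norm ?ReNorm_ge0// -ltcR -normcRe.
Qed.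

Lemma cvg_geometric_increments (w : nat -> R) (B rho : R) :
  0 <= rho < 1 -> (forall n, `|w n.+1 - w n| <= B * rho ^+ n) ->
  exists l : R, w n @[n --> \oo] --> l.
Proof.
move=> /andP[rho0 rho1] wB.
have B0 : 0 <= B by have := le_trans (normr_ge0 _) (wB 0%N); rewrite mulr1.
have cs : cvgn (series (fun n => w n.+1 - w n)).
  apply: normed_cvg; apply: (series_le_cvg (v_ := geometric B rho)) => [n|n|n|].
  - exact: normr_ge0.
  - by rewrite /= mulr_ge0// exprn_ge0.
  - exact: wB.
  - by apply: is_cvg_geometric_series; rewrite ger0_norm.
have wE : w = (fun n => w 0%N + series (fun n => w n.+1 - w n) n).
  by apply/funext => n; rewrite /series /= telescope_sumr// addrC subrK.
exists (w 0%N + limn (series (fun n => w n.+1 - w n))); rewrite {1}wE.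
by apply: cvgD => //; exact: cvg_cst.
Qed.

Lemma normC_le_ReIm x :
  `|x| <= (`|complex.Re x| + `|complex.Im x|)%:C.
Proof.
rewrite {1}[x]complexE; apply: (le_trans (ler_normD _ _)).
rewrite rmorphD /= normrM.
have -> : `|'i : R[i]| = 1 by rewrite normc_def /= expr0n expr1n add0r sqrtr1.
rewrite mul1r; apply: lerD; rewrite normc_def /= expr0n addr0 sqrtr_sqr//.
Qed.

Lemma normC_ge_Im x : `|complex.Im x|%:C <= `|x|.
Proof.
rewrite normc_def lecR -sqrtr_sqr ler_wsqrtr// lerDr sqr_ge0//.
Qed.

(** Completeness enters here, through the real and the imaginary part. *)
Lemma cvgC_geometric_increments u (B rho : R) :
  0 <= rho < 1 -> (forall n, `|u n.+1 - u n| <= (B * rho ^+ n)%:C) ->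
  exists l : C, u n @[n --> \oo] --> l.
Proof.
move=> rho01 uB.
have [a ca] : exists l : R, complex.Re (u n) @[n --> \oo] --> l.
  apply: (cvg_geometric_increments (B := B) rho01) => n.
  rewrite -lecR -raddfB; apply: le_trans (uB n); exact: normc_ge_Re.
have [b cb] : exists l : R, complex.Im (u n) @[n --> \oo] --> l.
  apply: (cvg_geometric_increments (B := B) rho01) => n.
  rewrite -lecR -raddfB; apply: le_trans (uB n); exact: normC_ge_Im.
exists (a +i* b); apply: (@cvgC_dominated _ _
  (fun n => `|complex.Re (u n) - a| + `|complex.Im (u n) - b|)) => [n|].
  by apply: le_trans (normC_le_ReIm _) _; rewrite !raddfB.
have dist0 (w : nat -> R) (c : R) :
    w n @[n --> \oo] --> c -> `|w n - c| @[n --> \oo] --> (0 : R).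
  move=> wc; have -> : 0 = `|c - c| by rewrite subrr normr0.
  by apply: cvg_norm; apply: cvgB => //; exact: cvg_cst.
by rewrite -[X in _ --> X]addr0; apply: cvgD; exact: dist0.
Qed.

(** By [1 + x <= expR x], the products stay below the exponential of a convergent geometric
    series. *)
Lemma prod_geometric_bounded (B rho : R) : 0 <= B -> 0 <= rho < 1 ->
  exists M, forall n, \prod_(0 <= j < n) (1 + B * rho ^+ j) <= M.
Proof.
move=> B0 /andP[rho0 rho1].
have [l cl] : exists l : R, series (geometric B rho) n @[n --> \oo] --> l.
  by apply/cvg_ex; apply: is_cvg_geometric_series; rewrite ger0_norm.
have [M M0 MP] := cvg_seq_le_bound cl.
exists (expR M) => n.
apply: (@le_trans _ _ (expR (series (geometric B rho) n))); last first.
  by rewrite ler_expR; apply: le_trans (ler_norm _) _.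
rewrite /series /= expR_sum; apply: ler_prod => j _.
by rewrite expR_ge1Dx andbT addr_ge0// mulr_ge0// exprn_ge0.
Qed.

Lemma cvg_prod_geometric (e : nat -> C) (B rho : R) :
  0 <= rho < 1 -> (forall n, `|e n| <= (B * rho ^+ n)%:C) ->
  exists l : C, \prod_(0 <= j < n) (1 + e j) @[n --> \oo] --> l.
Proof.
move=> rho01 eB; have /andP[rho0 rho1] := rho01.
have B0 : 0 <= B.
  by rewrite -lecR; have := le_trans (normr_ge0 _) (eB 0%N); rewrite mulr1.
have [M MP] := prod_geometric_bounded B0 rho01.
apply: (cvgC_geometric_increments (B := M * B) rho01) => n.
rewrite big_nat_recr//= mulrDr mulr1 addrC addKr normrM -mulrA.
rewrite [(M * _)%:C]rmorphM; apply: ler_pM => //.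
rewrite normr_prod.
apply: (@le_trans _ _ (\prod_(0 <= j < n) (1 + B * rho ^+ j))%:C).
  rewrite rmorph_prod; apply: ler_prod => j _; rewrite normr_ge0 /=.
  by apply: le_trans (ler_normD _ _) _; rewrite normr1 rmorphD lerD2l.
by rewrite lecR.
Qed.

Lemma normq_rho q : `|q| < 1 -> 0 <= complex.Re `|q| < 1.
Proof. by move=> q1; rewrite ReNorm_ge0 -ltcR -normcRe. Qed.

Lemma cvg_qpoch x q : `|q| < 1 ->
  qpoch x q n%:Z @[n --> \oo] --> qpochoo x q.
Proof.
move=> q1; suff [l cl] : exists l : C, qpoch x q n%:Z @[n --> \oo] --> l.
  by rewrite /qpochoo (cvg_lim _ cl).
rewrite (_ : (fun n : nat => _)
    = (fun n => \prod_(0 <= j < n) (1 - x * q ^+ j))); last first.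
  by apply/funext => n; rewrite qpoch_natE.
apply: (@cvg_prod_geometric _ (complex.Re `|x|) _ (normq_rho q1)) => n.
by rewrite normrN normrM normrX rmorphM rmorphXn /= -!normcRe.
Qed.

(** The inverses are again partial products, since [1/(1-y) = 1 + y/(1-y)], and therefore converge.
    The two limits multiply to 1, so [(x;q)_oo] is nonzero as soon as its factors are. *)
Lemma cvg_qpochV x q : `|q| < 1 -> (forall n, 1 - x * q ^+ n != 0) ->
  exists2 l : C, (qpoch x q n%:Z)^-1 @[n --> \oo] --> l & qpochoo x q * l = 1.
Proof.
move=> q1 x1.
have [M M0 MP] : exists2 M : C, 0 < M & forall n, `|(1 - x * q ^+ n)^-1| <= M.
  have c1 : 1 - x * q ^+ n @[n --> \oo] --> (1 : C).
    rewrite -[X in _ --> X]subr0 -[X in _ --> _ - X](mulr0 x).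
    apply: cvgB; first exact: cvg_cst.
    by apply: cvgM; [exact: cvg_cst|exact: cvg_expC].
  exact: (cvg_seq_le_bound (cvgV (oner_neq0 _) c1)).
have ME : M = (complex.Re M)%:C by rewrite RRe_real// gtr0_real.
suff [l cl] : exists l : C, (qpoch x q n%:Z)^-1 @[n --> \oo] --> l.
  exists l => //.
  have c1 : qpoch x q n%:Z * (qpoch x q n%:Z)^-1 @[n --> \oo]
      --> qpochoo x q * l.
    exact: (cvgM (cvg_qpoch (x := x) q1) cl).
  have c2 : (fun n : nat => qpoch x q n%:Z * (qpoch x q n%:Z)^-1) = (fun=> 1).
    apply/funext => n; rewrite mulfV// qpoch_natE prodf_seq_neq0.
    by apply/allP => j _; exact: x1.
  rewrite c2 in c1; rewrite -(cvg_lim (@norm_hausdorff _ C) c1).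
  by apply: cvg_lim; [exact: norm_hausdorff|exact: cvg_cst].
have -> : (fun n : nat => (qpoch x q n%:Z)^-1)
    = (fun n => \prod_(0 <= j < n) (1 + x * q ^+ j / (1 - x * q ^+ j))).
  apply/funext => n; rewrite qpoch_natE -prodfV; apply: eq_bigr => j _.
  by field; rewrite x1.
apply: (@cvg_prod_geometric _ (complex.Re `|x| * complex.Re M) _
  (normq_rho q1)) => n.
rewrite !normrM normrX mulrAC !rmorphM rmorphXn /= -!normcRe -ME.
by rewrite ler_wpM2r ?exprn_ge0// ler_wpM2l.
Qed.

Lemma qpochoo_neq0 x q : `|q| < 1 -> (forall n, 1 - x * q ^+ n != 0) ->
  qpochoo x q != 0.
Proof.
move=> q1 /(cvg_qpochV q1)[l _ /eqP]; apply: contraTneq => ->.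
by rewrite mul0r eq_sym oner_neq0.
Qed.

(** A vanishing factor makes the partial products eventually 0. This turns the nonvanishing
    prefactor into a condition on each factor. *)
Lemma qpochoo_factor_neq0 x q : `|q| < 1 -> qpochoo x q != 0 ->
  forall n, 1 - x * q ^+ n != 0.
Proof.
move=> q1 xoo n; apply: contra xoo => /eqP xn.
apply/eqP; rewrite -(cvg_lim (@norm_hausdorff _ C) (cvg_qpoch (x := x) q1)).
apply: cvg_lim; first exact: norm_hausdorff.
apply: cvg_near_cst; near=> m.
apply/eqP; rewrite qpoch_natE prodf_seq_eq0; apply/hasP.
exists n; last by rewrite xn eqxx.
by rewrite mem_index_iota /=; near: m; exact: nbhs_infty_gt.
Unshelve. all: by end_near. Qed.

Lemma cvg_qpoch_inv x q : `|q| < 1 -> (forall n, 1 - x * q ^+ n != 0) ->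
  (qpoch x q n%:Z)^-1 @[n --> \oo] --> (qpochoo x q)^-1.
Proof.
by move=> q1 x1; apply: cvgV; [exact: qpochoo_neq0|exact: cvg_qpoch].
Qed.

Lemma qpoch_inv_bounded x q : `|q| < 1 -> (forall n, 1 - x * q ^+ n != 0) ->
  exists2 M : C, 0 < M & forall n : nat, `|(qpoch x q n%:Z)^-1| <= M.
Proof. by move=> q1 x1; exact: cvg_seq_le_bound (cvg_qpoch_inv q1 x1). Qed.
End ComplexLimits.

(** * Summability *)

Lemma ler_sum_subset (R : numDomainType) (I : eqType) (f : I -> R)
    (B Y : seq I) :
  (forall k, 0 <= f k) -> uniq B -> uniq Y -> {subset B <= Y} ->
  \sum_(k <- B) f k <= \sum_(k <- Y) f k.
Proof.
move=> f0 uB uY BY.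
by rewrite (sum_subset_split f uY uB BY) lerDl sumr_ge0.
Qed.

(** A finite set of sequences of length [n + 1] lies in the product of its heads by its tails, over
    which the sum factors. *)
Lemma sum_prod_seq_le (R : numDomainType) (T : eqType) (w : T -> R) (S : R) :
  (forall k, 0 <= w k) -> 0 <= S ->
  (forall B, uniq B -> \sum_(k <- B) w k <= S) ->
  forall n (B : seq (seq T)), uniq B -> {in B, forall s, size s = n} ->
  \sum_(s <- B) \prod_(k <- s) w k <= S ^+ n.
Proof.
move=> w0 S0 wS; elim=> [|n IHn] B uB sB.
  apply: (@le_trans _ _ (\sum_(s <- [:: [::]]) \prod_(k <- (s : seq T)) w k)).
    apply: ler_sum_subset => // [s|s /sB/size0nil->]; last by rewrite mem_head.
    by apply: prodr_ge0.
  by rewrite big_seq1 big_nil.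
case: B => [|[|x0 s0] B] in uB sB *; first by rewrite big_nil exprn_ge0.
  by have := sB _ (mem_head _ _).
set B' := _ :: B in uB sB *.
pose heads := undup [seq head x0 s | s <- B'].
pose tails := undup [seq behead s | s <- B'].
apply: (@le_trans _ _
    (\sum_(s <- [seq k :: s | k <- heads, s <- tails]) \prod_(k <- s) w k)).
  apply: ler_sum_subset => // [s||s sB']; first by apply: prodr_ge0.
    apply: allpairs_uniq; rewrite ?undup_uniq//.
    by move=> -[? ?] [? ?] _ _ /= [-> ->].
  apply/allpairsP; exists (head x0 s, behead s); rewrite !mem_undup; split.
  - exact: (map_f (head x0)).
  - exact: (map_f behead).
  - by have := sB _ sB'; case: (s).
rewrite big_allpairs_dep /= exprS.
under eq_bigr do (under eq_bigr do rewrite big_cons); rewrite /=.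
under eq_bigr do rewrite -mulr_sumr.
rewrite -mulr_suml; apply: ler_pM; rewrite ?sumr_ge0//.
- by move=> s _; apply: prodr_ge0.
- by apply: wS; rewrite undup_uniq.
apply: IHn => [|s]; first by rewrite undup_uniq.
by rewrite mem_undup => /mapP[t /sB st ->]; rewrite size_behead st.
Qed.

Lemma norm_expz_le (K : numFieldType) (x : K) (k : int) :
  `|x ^ k| <= (`|x| + `|x^-1|) ^+ absz k.
Proof.
case: k => n /=; rewrite ?NegzE -?invr_expz -exprnP -?exprVn normrX.
  by rewrite lerXn2r ?nnegrE ?addr_ge0// lerDl.
by rewrite lerXn2r ?nnegrE ?addr_ge0// lerDr.
Qed.

Section Summability.
Variable R : realType.
Local Notation C := (complexField R).
Local Notation h := (2^-1 : R).

Lemma half_ge0 n : 0 <= h ^+ n.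
Proof. by rewrite exprn_ge0// invr_ge0. Qed.

Lemma sum_half_nat n : \sum_(i <- iota 0 n) h ^+ i <= 2.
Proof.
suff -> : \sum_(i <- iota 0 n) h ^+ i = 2 - 2 * h ^+ n.
  by rewrite gerBl mulr_ge0// half_ge0.
elim: n => [|n IHn]; first by rewrite big_nil expr0 mulr1 subrr.
by rewrite -addn1 iotaD big_cat /= IHn big_seq1 addn1 exprS; field.
Qed.

Lemma sum_half_int (B : seq int) : uniq B -> \sum_(k <- B) h ^+ absz k <= 3.
Proof.
move=> uB; pose N := \max_(k <- B) (absz k).+1.
pose Y := [seq Posz n | n <- iota 0 N] ++ [seq Negz n | n <- iota 0 N].
apply: (@le_trans _ _ (\sum_(k <- Y) h ^+ absz k)).
  apply: ler_sum_subset => // [k||k kB]; first exact: half_ge0.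
    rewrite cat_uniq !map_inj_uniq ?iota_uniq ?andbT/=; try by move=> ? ? [].
    by apply/hasPn => _ /mapP[n _ ->]; apply/mapP => -[].
  have kN : (absz k < N)%N by rewrite /N (big_rem k)//= leq_max leqnn.
  rewrite mem_cat; case: k kN {kB} => n /= nN; apply/orP; [left|right];
    by rewrite map_f// mem_iota; lia.
(* The nonnegative integers contribute at most 2; [Negz n] has absolute value [n + 1], so the
   negative ones contribute at most half of that. *)
rewrite big_cat !big_map /= (_ : 3 = 2 + 1); last by ring.
apply: lerD; first exact: sum_half_nat.
under eq_bigr do rewrite exprS; rewrite -mulr_sumr.
by have := sum_half_nat N; lra.
Qed.

Lemma sum_half_seq n (B : seq (seq int)) : uniq B ->
  {in B, forall s, size s = n} ->
  \sum_(s <- B) \prod_(k <- s) h ^+ absz k <= 3 ^+ n.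
Proof.
move=> uB sB; apply: sum_prod_seq_le => // [k|]; first exact: half_ge0.
exact: sum_half_int.
Qed.

(** Consecutive terms have ratio [B rho^n], at most 1 from some [n0] on, so the sum of the terms up
    to [n0] bounds them all. *)
Lemma superexp_bounded (B rho : R) : 0 <= B -> 0 <= rho < 1 ->
  exists2 M, 0 <= M & forall n, B ^+ n * rho ^+ 'C(n, 2) <= M.
Proof.
move=> B0 /andP[rho0 rho1]; pose u n := B ^+ n * rho ^+ 'C(n, 2).
have u0 n : 0 <= u n by rewrite mulr_ge0// exprn_ge0.
have : B * rho ^+ n @[n --> \oo] --> (0 : R).
  rewrite -[X in _ --> X](mulr0 B); apply: cvgM; first exact: cvg_cst.
  by apply: cvg_expr; rewrite ger0_norm.
move=> /cvgrPdist_le/(_ 1 ltr01)[n0 _ n0P].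
exists (\sum_(0 <= j < n0.+1) u j); first by rewrite sumr_ge0.
have base n : (n <= n0)%N -> u n <= \sum_(0 <= j < n0.+1) u j.
  move=> nn0; rewrite (bigD1_seq n) ?iota_uniq ?mem_index_iota//= lerDl.
  by rewrite sumr_ge0.
move=> n; rewrite -/(u n); have [/base//|/ltnW] := leqP n n0.
elim: n => [|n IHn].
  by rewrite leqn0 => /eqP n00; apply: base; rewrite n00.
rewrite leq_eqVlt => /predU1P[<-|n0n]; first exact: base.
apply: le_trans (IHn n0n).
have -> : u n.+1 = u n * (B * rho ^+ n).
  by rewrite /u binS bin1 exprS exprD; ring.
rewrite ler_piMr//; have := n0P n n0n; rewrite /= sub0r normrN ger0_norm//.
by rewrite mulr_ge0// exprn_ge0.
Qed.

Lemma superexpC_bounded (B rho : C) : 0 <= B -> 0 <= rho -> rho < 1 ->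
  exists2 M : R, 0 <= M & forall n,
    B ^+ n * rho ^+ 'C(n, 2) <= (M * (h ^+ n * h ^+ n))%:C.
Proof.
move=> B0 rho0 rho1.
have BE : B = (complex.Re B)%:C by rewrite RRe_real// ger0_real.
have rhoE : rho = (complex.Re rho)%:C by rewrite RRe_real// ger0_real.
(* Bounding the terms with base [4 B] gains the factor [4^(-n) = h^n h^n]. *)
have B'0 : 0 <= 4 * complex.Re B by rewrite mulr_ge0// -lecR -BE.
have rho'01 : 0 <= complex.Re rho < 1 by rewrite -lecR -ltcR -rhoE rho0.
have [M M0 MP] := superexp_bounded B'0 rho'01; exists M => // n.
rewrite BE rhoE -!rmorphXn -rmorphM lecR /=.
have := MP n; rewrite exprMn => MPn.
have -> : complex.Re B ^+ n * complex.Re rho ^+ 'C(n, 2)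
  = (4 ^+ n * complex.Re B ^+ n * complex.Re rho ^+ 'C(n, 2))
    * (h ^+ n * h ^+ n).
  have -> : h ^+ n * h ^+ n = (4 ^+ n)^-1.
    by rewrite -exprMn -exprVn; congr (_ ^+ _); field.
  by rewrite [RHS]mulrC !mulrA mulVf ?mul1r// expf_neq0// pnatr_eq0.
by rewrite ler_wpM2r// mulr_ge0// half_ge0.
Qed.

(** This is why [h^nu] occurs twice in the majorants: off [Y N] one copy is at most [h^N], while the
    other has sums bounded by [S]. *)
Lemma small_tails_geometric (I : choiceType) (nu : I -> nat) (Y : nat -> seq I)
    (S M : R) :
  (forall N, uniq (Y N)) -> (forall N k, k \notin Y N -> (N <= nu k)%N) ->
  0 <= M -> (forall B, uniq B -> \sum_(k <- B) h ^+ nu k <= S) ->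
  small_tails (fun k => (M * (h ^+ nu k * h ^+ nu k))%:C : C).
Proof.
move=> uY Ynu M0 sumS e e0.
have eE : e = (complex.Re e)%:C by rewrite RRe_real// gtr0_real.
have e'0 : 0 < complex.Re e by rewrite -ltcR -eE.
have : M * S * h ^+ n @[n --> \oo] --> (0 : R).
  rewrite -[X in _ --> X](mulr0 (M * S)); apply: cvgM; first exact: cvg_cst.
  by apply: cvg_expr; rewrite ger0_norm ?invr_ge0// invf_lt1 ?ltr1n.
move=> /cvgrPdist_le/(_ _ e'0)[N _ /(_ N (leqnn N))].
rewrite /= sub0r normrN => NP.
exists (Y N) => // B uB BY; rewrite -rmorph_sum eE lecR -mulr_sumr /=.
apply: le_trans (ler_norm _) _.
apply: le_trans NP; rewrite !normrM -mulrA ler_wpM2l//.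
rewrite (@ger0_norm _ (h ^+ N)) ?half_ge0//.
apply: (@le_trans _ _ (\sum_(k <- B) h ^+ nu k * h ^+ N)).
  rewrite ger0_norm;
    last by rewrite sumr_ge0// => k _; rewrite mulr_ge0// half_ge0.
  rewrite big_seq_cond [leRHS]big_seq_cond; apply: ler_sum => k.
  rewrite andbT => /BY/Ynu Nk; rewrite ler_wpM2l ?half_ge0//.
  by rewrite ler_wiXn2l// ?invr_ge0// invf_le1 ?ler1n.
rewrite -mulr_suml ler_wpM2r ?half_ge0//.
by apply: le_trans (ler_norm _); exact: sumS.
Qed.
End Summability.

(** * Theta series *)

Lemma cvg_int_shift (K : numFieldType) (u : int -> K) (l : K) (j : int) :
  u n%:Z @[n --> \oo] --> l -> u (N%:Z + j) @[N --> \oo] --> l.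
Proof.
move=> ul; apply/cvgrPdist_le => e e0.
move/cvgrPdist_le : ul => /(_ e e0)[n0 _ n0P].
exists (n0 + absz j)%N => // N /= NN.
have -> : N%:Z + j = (absz (N%:Z + j))%:Z by lia.
by apply: n0P => /=; lia.
Qed.

Lemma near_mem_zrange (j : int) : \forall N \near \oo, j \in zrange N.
Proof. by exists (absz j) => // N /= jN; rewrite mem_zrange; lia. Qed.

Lemma tri_ge (j : int) : exists m : nat, tri j = ('C(absz j, 2) + m)%:Z.
Proof.
have := tri2 (absz j)%:Z; rewrite tri_nat => t2; have tj := tri2 j.
case: j => n in t2 tj *.
  by exists 0%N; rewrite addn0; move: t2 tj => /=; lia.
by exists n.+1; move: t2 tj; rewrite PoszD /= NegzE; lia.
Qed.

Section ThetaLimits.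
Variable R : realType.
Local Notation C := (complexField R).
Local Notation h := (2^-1 : R).
Implicit Types (q x z : C).

Lemma theta_bound q x : `|q| < 1 -> exists2 M : R, 0 <= M & forall j,
  `|theta q x j| <= (M * (h ^+ absz j * h ^+ absz j))%:C.
Proof.
move=> q1; have B0 : 0 <= `|- x| + `|(- x)^-1| by rewrite addr_ge0.
have [M M0 MP] := superexpC_bounded B0 (normr_ge0 q) q1; exists M => // j.
apply: le_trans (MP _); rewrite normrM; apply: ler_pM => //.
  exact: norm_expz_le.
have [m ->] := tri_ge j; rewrite -exprnP normrX exprD.
by rewrite ler_piMr ?exprn_ge0// exprn_ile1// ltW.
Qed.

Lemma theta_tannery q x (c : nat -> int -> C) (c0 M : C) : `|q| < 1 ->
  (forall N j, j \in zrange N -> `|c N j| <= M) ->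
  (forall j, c N j @[N --> \oo] --> c0) ->
  \sum_(j <- zrange N) theta q x j * c0
  - \sum_(j <- zrange N) theta q x j * c N j @[N --> \oo] --> (0 : C).
Proof.
move=> q1 cM cc0; have [T T0 TP] := theta_bound x q1.
have M0 : 0 <= M by apply: le_trans (cM 0%N 0 _); rewrite ?normr_ge0.
(* A single constant dominating both the weights and their limit. *)
pose M' := M + `|c0|.
have M'0 : 0 <= M' by rewrite addr_ge0.
have M'E : M' = (complex.Re M')%:C by rewrite RRe_real// ger0_real.
have M''0 : 0 <= complex.Re M' by rewrite -lecR -M'E.
pose g := fun j : int =>
  (complex.Re M' * T * (h ^+ absz j * h ^+ absz j))%:C : C.
have gE j : g j = (T * (h ^+ absz j * h ^+ absz j))%:C * M'.
  by rewrite M'E -rmorphM /g -mulrA mulrC.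
apply: (@tannery_cvg C int _ g (fun N j => theta q x j * c N j) zrange).
- exact: uniq_zrange.
- exact: near_mem_zrange.
- by move=> k; apply: cvgM; [exact: cvg_cst|exact: cc0].
- move=> N k kN; rewrite gE normrM ler_pM//.
  by apply: le_trans (cM _ _ kN) _; rewrite lerDl.
- by move=> k; rewrite gE normrM ler_pM// lerDr.
- apply: (@small_tails_geometric R int absz zrange 3).
  + exact: uniq_zrange.
  + by move=> N k; rewrite mem_zrange; lia.
  + by rewrite mulr_ge0.
  + exact: sum_half_int.
Qed.

Lemma onem_qX q n : `|q| < 1 -> 1 - q ^+ n.+1 != 0.
Proof.
move=> q1; rewrite subr_eq0; apply/eqP => qn.
have : `|q ^+ n.+1| < 1 by rewrite normrX exprn_ilt1.
by rewrite -qn normr1 ltxx.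
Qed.

Lemma onem_qqX q n : `|q| < 1 -> 1 - q * q ^+ n != 0.
Proof. by move=> q1; rewrite -exprS onem_qX. Qed.

Lemma qpochq_inv_bounded q : q != 0 -> `|q| < 1 ->
  exists2 M : C, 0 < M & forall k, `|(qpoch q q k)^-1| <= M.
Proof.
move=> q0 q1; have [M M0 MP] := qpoch_inv_bounded q1 (fun n => onem_qqX n q1).
exists M => // -[n|n]; first exact: MP.
by rewrite qpochq_lt0// normr0 ltW.
Qed.

Lemma cvg_qpoch_inv_shift q x (j : int) : `|q| < 1 ->
  (forall n, 1 - x * q ^+ n != 0) ->
  (qpoch x q (N%:Z + j))^-1 @[N --> \oo] --> (qpochoo x q)^-1.
Proof.
move=> q1 x1.
exact: (@cvg_int_shift C (fun k => (qpoch x q k)^-1) _ j (cvg_qpoch_inv q1 x1)).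
Qed.

(** With the weights tending to [c0 = 1/(q;q)_oo^2], dominated convergence identifies [c0] times the
    theta series with the limit [(x, q/x;q)_oo / (q;q)_oo] of the finite product. *)
Lemma jacobi_triple_product q x : q != 0 -> `|q| < 1 -> x != 0 ->
  \sum_(j <- zrange N) theta q x j @[N --> \oo]
  --> qpochoo q q * qpochsoo [:: x; q / x] q.
Proof.
move=> q0 q1 x0; have qq1 n := onem_qqX n q1.
have qoo0 : qpochoo q q != 0 := qpochoo_neq0 q1 qq1.
have [M M0 MP] := qpochq_inv_bounded q0 q1.
pose c (N : nat) (j : int) :=
  (qpoch q q (N%:Z + j))^-1 * (qpoch q q (N%:Z - j))^-1.
pose c0 := (qpochoo q q)^-1 * (qpochoo q q)^-1.
have cM N j : j \in zrange N -> `|c N j| <= M * M by rewrite normrM ler_pM.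
have cc0 j : c N j @[N --> \oo] --> c0.
  by apply: cvgM; exact: cvg_qpoch_inv_shift.
have tan := theta_tannery x q1 cM cc0.
have c0E N : \sum_(j <- zrange N) theta q x j * c N j
    = qpoch x q N%:Z * qpoch (q / x) q N%:Z * (qpoch q q (N + N)%:Z)^-1.
  rewrite finite_triple_product// => [|n]; last exact: onem_qX.
  by apply: eq_bigr => j _; rewrite /c mulrA.
have lim : \sum_(j <- zrange N) theta q x j * c N j @[N --> \oo]
    --> qpochoo x q * qpochoo (q / x) q * (qpochoo q q)^-1.
  rewrite (_ : (fun N => _)
    = (fun N : nat => qpoch x q N%:Z * qpoch (q / x) q N%:Z
    * (qpoch q q (N + N)%:Z)^-1)); last by apply/funext => N; exact: c0E.
  apply: cvgM; first by apply: cvgM; exact: cvg_qpoch.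
  have := @cvg_comp _ _ _ (fun N => (N + N)%N)
    (fun n : nat => (qpoch q q n%:Z)^-1) \oo \oo _ _ (cvg_qpoch_inv q1 qq1).
  apply=> A [n0 _ n0P]; exists n0 => // N /= n0N; apply: n0P => /=.
  by rewrite (leq_trans n0N)// leq_addr.
have E : (fun N => \sum_(j <- zrange N) theta q x j)
    = (fun N => (\sum_(j <- zrange N) theta q x j * c0
         - \sum_(j <- zrange N) theta q x j * c N j
         + \sum_(j <- zrange N) theta q x j * c N j)
        * (qpochoo q q * qpochoo q q)).
  apply/funext => N; rewrite subrK -mulr_suml -mulrA.
  by rewrite /c0 mulrACA mulVf// mulr1 mulr1.
have -> : qpochoo q q * qpochsoo [:: x; q / x] q
    = (0 + qpochoo x q * qpochoo (q / x) q * (qpochoo q q)^-1)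
      * (qpochoo q q * qpochoo q q).
  rewrite /qpochsoo big_cons big_seq1 add0r.
  move: (qpochoo x q) (qpochoo (q / x) q) (qpochoo q q) qoo0.
  by move=> a b c' c'0; rewrite -mulrA mulKf// mulrC.
rewrite E; exact: (cvgM (cvgD tan lim) (cvg_cst _)).
Qed.

Lemma theta_weighted_cvg q x (c : nat -> int -> C) (c0 M : C) :
  q != 0 -> `|q| < 1 -> x != 0 ->
  (forall N j, j \in zrange N -> `|c N j| <= M) ->
  (forall j, c N j @[N --> \oo] --> c0) ->
  \sum_(j <- zrange N) theta q x j * c N j @[N --> \oo]
  --> qpochoo q q * qpochsoo [:: x; q / x] q * c0.
Proof.
move=> q0 q1 x0 cM cc0; have tan := theta_tannery x q1 cM cc0.
have jtp : (\sum_(j <- zrange N) theta q x j) * c0 @[N --> \oo]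
    --> qpochoo q q * qpochsoo [:: x; q / x] q * c0.
  exact: (cvgM (jacobi_triple_product q0 q1 x0) (cvg_cst c0)).
have E : (fun N => \sum_(j <- zrange N) theta q x j * c N j)
    = (fun N => (\sum_(j <- zrange N) theta q x j) * c0
         - (\sum_(j <- zrange N) theta q x j * c0
            - \sum_(j <- zrange N) theta q x j * c N j)).
  by apply/funext => N; rewrite -mulr_suml opprB addrCA subrr addr0.
rewrite E.
have -> : qpochoo q q * qpochsoo [:: x; q / x] q * c0
    = qpochoo q q * qpochsoo [:: x; q / x] q * c0 - 0 by rewrite subr0.
exact: (cvgB jtp tan).
Qed.
End ThetaLimits.

(** * The limit *)

Section Bounds.
Variables (K : numFieldType) (q z : K).
Hypotheses (q0 : q != 0) (q1 : `|q| < 1) (z0 : z != 0).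
Local Notation rho := `|q|.

(** [k^2] is twice ['C(|k|, 2)] plus [|k|]. Of the two copies of [rho^'C(|k|, 2)], one will offset
    the growth of [1/(zq;q)_k] and the other gives convergence. *)
Lemma norm_sqr_factor_le (c : nat) (k : int) : (c <= 1)%N ->
  `|(z ^+ 2 * q ^ c%:Z) ^ k * q ^ (k * k)|
  <= (`|z ^+ 2| + `|(z ^+ 2)^-1|
      + (`|z ^+ 2 * q| + `|(z ^+ 2 * q)^-1|)) ^+ absz k
     * (rho ^+ 'C(absz k, 2) * rho ^+ 'C(absz k, 2)).
Proof.
move=> c1; rewrite normrM; apply: ler_pM => //.
  apply: le_trans (norm_expz_le _ _) _; rewrite lerXn2r ?nnegrE ?addr_ge0//.
  case: c c1 => [|[|//]] _; rewrite ?expr0z ?expr1z ?mulr1.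
    by rewrite lerDl addr_ge0.
  by rewrite lerDr addr_ge0.
have -> : k * k = ('C(absz k, 2) + 'C(absz k, 2) + absz k)%N%:Z.
  by have := tri2 (absz k)%:Z; rewrite tri_nat; lia.
rewrite -exprnP normrX !exprD ler_piMr ?mulr_ge0 ?exprn_ge0//.
by rewrite exprn_ile1// ltW.
Qed.

(** For [k = -n] reversal gives [1/(zq;q)_k = (1/z;q)_n (-z)^n q^(-tri n)], of Gaussian growth. *)
Lemma inv_qpoch_growth (M : K) : (forall e : int, 1 - z * q ^ e != 0) ->
  0 < M ->
  (forall n : nat, `|(qpoch (z * q) q n%:Z)^-1| <= M) ->
  (forall n : nat, `|qpoch z^-1 q n%:Z| <= M) ->
  forall k, `|(qpoch (z * q) q k)^-1|
    <= M * ((1 + `|z|) ^+ absz k * rho^-1 ^+ 'C(absz k, 2)).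
Proof.
move=> z1 M0 M1 M2 k.
have rho0 : 0 < rho by rewrite normr_gt0.
have rhoV : 1 <= rho^-1 by rewrite invf_ge1// ltW.
case: k => n.
  apply: le_trans (M1 n) _; rewrite ler_peMr ?(ltW M0)// -[leLHS]mulr1.
  by apply: ler_pM => //; rewrite exprn_ege1// lerDl.
rewrite NegzE (qpoch_opp q0)// !invfM invrK mulrC !normrM.
apply: ler_pM => //; rewrite ?mulr_ge0//; first by rewrite invrK; exact: M2.
rewrite abszN; apply: ler_pM => //.
  by rewrite normrX normrN lerXn2r ?nnegrE ?addr_ge0// lerDr.
by rewrite normfV tri_nat -exprnP normrX exprVn.
Qed.
End Bounds.

Section SummandBound.
Variables (R : realType).
Local Notation C := (complexField R).
Local Notation h := (2^-1 : R).
Variables (r i : nat) (q z : C).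
Hypotheses (hr : (2 <= r)%N) (hi : (1 <= i <= r)%N).
Hypotheses (q0 : q != 0) (q1 : `|q| < 1) (z0 : z != 0).
Hypothesis z1 : forall e : int, 1 - z * q ^ e != 0.

Definition lambda_weight n (k : Lambda n) : nat :=
  \sum_(x <- lambda_seq k) absz x.

Lemma half_lambda_weight n (k : Lambda n) :
  h ^+ lambda_weight k = \prod_(x <- lambda_seq k) h ^+ absz x.
Proof.
rewrite /lambda_weight; elim/big_rec2: _ => [|x a b _ <-].
  by rewrite expr0.
by rewrite exprD.
Qed.

Lemma summand_bound : exists2 M : R, 0 <= M & forall k : Lambda r.-1,
  `|summand i q z k| <= (M * (h ^+ lambda_weight k * h ^+ lambda_weight k))%:C.
Proof.
have [M1 M10 M1P] := qpochq_inv_bounded q0 q1.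
have zq1 n : 1 - z * q * q ^+ n != 0.
  by have := z1 n.+1%:Z; rewrite -exprnP exprS mulrA.
have [M2 M20 M2P] := qpoch_inv_bounded q1 zq1.
have [M2' M2'0 M2'P] : exists2 M : C,
    0 < M & forall n : nat, `|qpoch z^-1 q n%:Z| <= M.
  exact: (cvg_seq_le_bound (cvg_qpoch (x := z^-1) q1)).
have M3 k : `|(qpoch (z * q) q k)^-1|
    <= (M2 + M2') * ((1 + `|z|) ^+ absz k * `|q|^-1 ^+ 'C(absz k, 2)).
  apply: inv_qpoch_growth => // [|n|n]; first exact: addr_gt0.
    by apply: le_trans (M2P n) _; rewrite lerDl ltW.
  by apply: le_trans (M2'P n) _; rewrite lerDr ltW.
set B := `|z ^+ 2| + `|(z ^+ 2)^-1| + (`|z ^+ 2 * q| + `|(z ^+ 2 * q)^-1|).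
have B0 : 0 <= B by rewrite !addr_ge0.
have BE0 : 0 <= B * (1 + `|z|) by rewrite mulr_ge0// addr_ge0.
have [M4 M40 M4P] := superexpC_bounded BE0 (normr_ge0 q) q1.
pose M5 := M1 ^+ r.-2 * (M2 + M2').
have M50 : 0 <= M5 by rewrite mulr_ge0 ?exprn_ge0 ?addr_ge0// ltW.
have M5E : M5 = (complex.Re M5)%:C by rewrite RRe_real// ger0_real.
exists (complex.Re M5 * M4 ^+ r.-1).
  by rewrite mulr_ge0 ?exprn_ge0// -lecR -M5E.
move=> k; rewrite summandE//.
set s := lambda_seq k; have ss : size s = r.-1 := size_lambda_seq k.
have rho0 : 0 < `|q| by rewrite normr_gt0.
pose D x := B ^+ absz x * (`|q| ^+ 'C(absz x, 2) * `|q| ^+ 'C(absz x, 2)) : C.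
pose G x := (1 + `|z|) ^+ absz x * `|q|^-1 ^+ 'C(absz x, 2) : C.
have D0 x : 0 <= D x by rewrite !mulr_ge0// exprn_ge0.
have G1 x : 1 <= G x.
  have e1 : 1 <= (1 + `|z|) ^+ absz x by rewrite exprn_ege1// lerDl.
  apply: le_trans e1 _; rewrite ler_peMr ?exprn_ge0 ?addr_ge0//.
  by rewrite exprn_ege1// invf_ge1// ltW.
have G0 x : 0 <= G x by apply: le_trans (G1 x).
have bA : `|\prod_(0 <= j < r.-1)
      ((z ^+ 2 * q ^ (shifts r i)`_j) ^ s`_j * q ^ (s`_j * s`_j))|
    <= \prod_(x <- s) D x.
  rewrite [leRHS](big_nth 0) ss normr_prod big_nat_cond [leRHS]big_nat_cond.
  apply: ler_prod => j /andP[/andP[_ jr] _]; rewrite normr_ge0 nth_shifts//.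
  by apply: norm_sqr_factor_le => //; case: (i <= j.+1)%N.
have bP : `|\prod_(1 <= j < r.-1) (qpoch q q (s`_j.-1 - s`_j))^-1|
    <= M1 ^+ r.-2.
  rewrite normr_prod (_ : M1 ^+ r.-2 = \prod_(1 <= j < r.-1) M1); last first.
    by rewrite prodr_const_nat subn1.
  by apply: ler_prod => j _; rewrite normr_ge0 M1P.
(* Only the last entry meets a growing factor; as [G >= 1], its bound extends to the product over
   all entries, so that each [D x] pairs with a [G x]. *)
have bV : `|(qpoch (z * q) q (last 0 s))^-1| <= (M2 + M2') * \prod_(x <- s) G x.
  apply: le_trans (M3 _) _.
  rewrite ler_wpM2l ?(ltW (addr_gt0 M20 M2'0))// -/(G _).
  have ls : last 0 s \in s.
    have : (0 < size s)%N by rewrite ss; case: (r) hr => [|[|]].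
    by case: (s) => // x t _; rewrite /= mem_last.
  rewrite (big_rem _ ls) /= ler_peMr//.
  by elim/big_rec: _ => // x a _ a1; rewrite -[leLHS]mulr1 ler_pM.
apply: (@le_trans _ _ ((\prod_(x <- s) D x) * M1 ^+ r.-2
  * ((M2 + M2') * \prod_(x <- s) G x))).
  rewrite normrM; apply: ler_pM => //.
  by rewrite normrM; apply: ler_pM.
have -> : (\prod_(x <- s) D x) * M1 ^+ r.-2 * ((M2 + M2') * \prod_(x <- s) G x)
    = M5 * \prod_(x <- s) (D x * G x).
  rewrite [in RHS]big_split /= /M5.
  move: (\prod_(x <- s) D x) (\prod_(x <- s) G x) => a b.
  by rewrite [a * _]mulrC mulrACA.
have -> : (complex.Re M5 * M4 ^+ r.-1
      * (h ^+ lambda_weight k * h ^+ lambda_weight k))%:C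
    = M5 * (M4 ^+ r.-1 * (h ^+ lambda_weight k * h ^+ lambda_weight k))%:C.
  by rewrite [in RHS]M5E -[in LHS]mulrA rmorphM.
rewrite ler_wpM2l// !half_lambda_weight -/s.
have -> : M4 ^+ r.-1 = \prod_(x <- s) M4.
  by rewrite big_const_seq count_predT ss -Monoid.iteropE.
rewrite -!big_split rmorph_prod /=; apply: ler_prod => x _.
rewrite mulr_ge0//; apply: le_trans (M4P (absz x)).
rewrite /D /G exprMn exprVn mulrACA ler_wpM2l ?mulr_ge0 ?exprn_ge0 ?addr_ge0//.
by rewrite mulfK// expf_neq0// gt_eqF.
Qed.
End SummandBound.

(** The factors of [(1/x;q)_oo] control the exponents [e <= 0], those of [(xq;q)_oo] the exponents
    [e >= 1]. *)
Lemma onem_expz_neq0 (K : fieldType) (q x : K) : q != 0 -> x != 0 ->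
  (forall n, 1 - x^-1 * q ^+ n != 0) -> (forall n, 1 - x * q * q ^+ n != 0) ->
  forall e : int, 1 - x * q ^ e != 0.
Proof.
move=> q0 x0 xV xq [[|n]|n].
- apply: contra (xV 0%N); rewrite expr0z !mulr1 !subr_eq0 => /eqP <-.
  by rewrite invr1.
- by have := xq n; rewrite -mulrA -exprS.
- apply: contra (xV n.+1).
  rewrite NegzE -invr_expz -exprnP !subr_eq0 => /eqP e1.
  by rewrite -[q ^+ _]invrK -invfM -e1 invr1.
Qed.

Lemma theta_complement (K : fieldType) (q z : K) (r c c' : nat) :
  q != 0 -> z != 0 -> (c + c' = r)%N ->
  q ^+ r / (z ^+ r * q ^+ c) = z ^- r * q ^+ c'.
Proof.
move=> q0 z0 <-; rewrite {1}addnC exprD invfM mulrCA mulfK//.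
by rewrite expf_neq0.
Qed.

Lemma prefactorE (K : fieldType) (p U W Y S1 S2 ze Q : K) : p != 0 ->
  p * p * (Y * (Q * S1 * (p^-1 * p^-1 * U^-1 * W^-1)
                + ze * (Q * S2 * (p^-1 * p^-1 * U^-1 * W^-1))))
  = Y / (U * W) * Q * (S1 + ze * S2).
Proof.
move=> p0; rewrite invfM; move: (U^-1) (W^-1) => U' W'.
by field.
Qed.

Section Limit.
Variables (R : realType).
Local Notation C := (complexField R).
Variables (r i : nat) (q z : C).
Hypothesis hi : (1 <= i <= r)%N.
Hypotheses (q0 : q != 0) (q1 : `|q| < 1) (z0 : z != 0).
Hypothesis hU : qpochoo (z ^+ 2)^-1 q != 0.
Hypothesis hW : qpochoo (z ^+ 2 * q) q != 0.

Let P k := (qpoch q q k)^-1.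
Let poo := qpochoo q q.
Let U1 := qpochoo_factor_neq0 q1 hU.
Let W1 := qpochoo_factor_neq0 q1 hW.
Let z20 : z ^+ 2 != 0. Proof. by rewrite expf_neq0. Qed.
Let z21 := onem_expz_neq0 q0 z20 U1 W1.
Let Q := q ^+ (2 * r + 1).

Let Q0 : Q != 0. Proof. by rewrite expf_neq0. Qed.
Let Q1 : `|Q| < 1. Proof. by rewrite normrX exprn_ilt1 ?addn1. Qed.

(* The weight attached to a theta term; [d] is 0 for the first theta series and
   1 for the second one. *)
Let weight (d : int) (N : nat) (j : int) : C :=
  P (N%:Z + (j - d)) * P (N%:Z - j)
  / qpoch (z ^+ 2)^-1 q (N%:Z + (d - j)) / qpoch (z ^+ 2 * q) q (N%:Z + j).

Let weight_lim : C :=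
  poo^-1 * poo^-1 / qpochoo (z ^+ 2)^-1 q / qpochoo (z ^+ 2 * q) q.

Lemma weight_cvg d j : weight d N j @[N --> \oo] --> weight_lim.
Proof.
have qq1 n := onem_qqX n q1.
apply: cvgM; last exact: cvg_qpoch_inv_shift.
apply: cvgM; last exact: cvg_qpoch_inv_shift.
by apply: cvgM; exact: cvg_qpoch_inv_shift.
Qed.

(** For [j] in the range and [0 <= d] both symbols in the denominator have nonnegative index, where
    their inverses are bounded; [P] is bounded at every index. *)
Lemma weight_bounded (d : int) : 0 <= d ->
  exists M : C, forall N j, j \in zrange N -> `|weight d N j| <= M.
Proof.
move=> d0; have [M1 M10 M1P] := qpochq_inv_bounded q0 q1.
have [M2 M20 M2P] := qpoch_inv_bounded q1 U1.
have [M3 M30 M3P] := qpoch_inv_bounded q1 W1.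
exists (M1 * M1 * M2 * M3) => N j; rewrite mem_zrange => /andP[jN Nj].
have -> : weight d N j = P (N%:Z + (j - d)) * P (N%:Z - j)
  / qpoch (z ^+ 2)^-1 q (absz (N%:Z + (d - j)))%:Z
  / qpoch (z ^+ 2 * q) q (absz (N%:Z + j))%:Z.
  rewrite /weight !gez0_abs//; first by rewrite addrC -lerBlDr sub0r.
  by rewrite addrCA addr_ge0// subr_ge0.
rewrite normrM; apply: ler_pM => //; rewrite normrM; apply: ler_pM => //.
by rewrite normrM; apply: ler_pM; rewrite ?M1P.
Qed.

Lemma theta_series_cvg (c c' : nat) (d : int) :
  (c + c' = 2 * r + 1)%N -> 0 <= d ->
  \sum_(j <- zrange N) theta Q (z ^+ (2 * r + 1) * q ^+ c) j * weight d N j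
    @[N --> \oo]
  --> qpochoo Q Q * qpochsoo [:: z ^+ (2 * r + 1) * q ^+ c;
        z ^- (2 * r + 1) * q ^+ c'] Q * weight_lim.
Proof.
move=> cr d0; have [M MP] := weight_bounded d0.
rewrite -(theta_complement q0 z0 cr).
apply: theta_weighted_cvg MP (weight_cvg d) => //.
by rewrite mulf_neq0// expf_neq0.
Qed.

Let S1 := qpochsoo [:: z ^+ (2 * r + 1) * q ^+ (2 * r + 1 - i);
                       z ^- (2 * r + 1) * q ^+ i] Q.
Let S2 := qpochsoo [:: z ^+ (2 * r + 1) * q ^+ i;
                       z ^- (2 * r + 1) * q ^+ (2 * r + 1 - i)] Q.
Let ze := z ^ (2 * i%:Z - 1 - 2 * r%:Z).

(** [poo * poo] makes up for the truncating factors [P (N - k_1) P (N + k_{r-1})], each of which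
    tends to [poo^-1]. *)
Lemma chain_cvg :
  poo * poo * chain q P z (qpoch (z * q) q) N (shifts r i) N%:Z @[N --> \oo]
  --> qpochoo z^-1 q / (qpochoo (z ^+ 2)^-1 q * qpochoo (z ^+ 2 * q) q)
      * qpochoo Q Q * (S1 + ze * S2).
Proof.
have ir : (i <= 2 * r + 1)%N.
  case/andP: hi => _ ir.
  by rewrite (leq_trans ir)// mul2n -addnn -addnA leq_addr.
have c1 := theta_series_cvg (subnK ir) (lexx 0).
have c2 := theta_series_cvg (subnKC ir) ler01.
have poo0 : poo != 0 := qpochoo_neq0 q1 (fun n => onem_qqX n q1).
rewrite -(prefactorE _ _ _ _ _ _ _ poo0).
rewrite (_ : (fun N : nat => _)
  = (fun N : nat => poo * poo * (qpoch z^-1 q N%:Z *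
  (\sum_(j <- zrange N)
     theta Q (z ^+ (2 * r + 1) * q ^+ (2 * r + 1 - i)) j * weight 0 N j
   + ze * \sum_(j <- zrange N)
     theta Q (z ^+ (2 * r + 1) * q ^+ i) j * weight 1 N j)))); last first.
  apply/funext => N; rewrite chain_closed_theta//;
    last by move=> n; exact: onem_qX.
  congr (_ * _ * (_ * (_ + _ * _))); apply: eq_bigr => j _; congr (_ * _).
    by rewrite /weight subr0 sub0r.
  by rewrite /weight addrA (addrC 1) addrA.
apply: cvgM; first exact: cvg_cst.
apply: cvgM; first exact: cvg_qpoch.
apply: cvgD; first exact: c1.
by apply: cvgM; [exact: cvg_cst|exact: c2].
Qed.
End Limit.

(** * Exhaustion by boxes and conclusion *)

Definition lambda_box (n N : nat) : seq (Lambda n) :=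
  pmap (@lambda_of_seq n) (zbox N n).

Lemma mem_lambda_box n N (k : Lambda n) :
  (k \in lambda_box n N) = all (mem (zrange N)) (lambda_seq k).
Proof.
rewrite /lambda_box (can2_mem_pmap (@lambda_of_seqK n) (@lambda_seqK n)).
by rewrite mem_zbox size_lambda_seq eqxx.
Qed.

Lemma uniq_lambda_box n N : uniq (lambda_box n N).
Proof. by apply: (pmap_uniq (@lambda_of_seqK n)); exact: uniq_zbox. Qed.

Lemma lambda_box_weight n N (k : Lambda n) :
  k \notin lambda_box n N -> (N <= lambda_weight k)%N.
Proof.
rewrite mem_lambda_box => /allPn[x xs /=]; rewrite mem_zrange => xN.
by rewrite /lambda_weight (big_rem x)//= ; lia.
Qed.

Lemma near_mem_lambda_box n (k : Lambda n) :
  \forall N \near \oo, k \in lambda_box n N.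
Proof.
exists (lambda_weight k).+1 => // N /= kN.
by apply: contraLR kN => /lambda_box_weight; lia.
Qed.

(** [pmap] discards the members of the box that are not nonincreasing, whose terms vanish. *)
Lemma sum_lambda_box (K : fieldType) (q z : K) (P V : int -> K) n N cs :
  (forall k : int, k < 0 -> P k = 0) -> size cs = n ->
  \sum_(k <- lambda_box n N) chain_term q P z V N cs N%:Z (lambda_seq k)
  = chain q P z V N cs N%:Z.
Proof.
move=> P_lt0 csn; rewrite -sum_chain_term csn /lambda_box big_pmap.
rewrite big_seq_cond [RHS]big_seq_cond; apply: eq_bigr => s.
rewrite andbT mem_zbox => /andP[/eqP sn _].
case E : (lambda_of_seq n s) => [k|] /=.
  by have := lambda_of_seqK n s; rewrite E /= => ->.
rewrite chain_term_unsorted ?sn//.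
by apply: contra (lambda_of_seq_None sn E) => /path_sorted.
Qed.

Section HasSum.
Variables (R : realType).
Local Notation C := (complexField R).
Local Notation h := (2^-1 : R).
Variables (r i : nat) (q z : C).
Hypotheses (hr : (2 <= r)%N) (hi : (1 <= i <= r)%N).
Hypotheses (q0 : q != 0) (q1 : `|q| < 1) (z0 : z != 0).
Hypothesis hU : qpochoo (z ^+ 2)^-1 q != 0.
Hypothesis hW : qpochoo (z ^+ 2 * q) q != 0.

Lemma sum_half_lambda n (B : seq (Lambda n)) : uniq B ->
  \sum_(k <- B) h ^+ lambda_weight k <= 3 ^+ n.
Proof.
move=> uB; under eq_bigr do rewrite half_lambda_weight.
rewrite -(big_map (@lambda_seq n) xpredT (fun s => \prod_(x <- s) h ^+ absz x)).
apply: sum_half_seq => [|s /mapP[k _ ->]]; last exact: size_lambda_seq.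
by rewrite map_inj_uniq//; exact: (pcan_inj (@lambda_seqK n)).
Qed.

Lemma has_sum_summand : has_sum (summand i q z : Lambda r.-1 -> C)
  (qpochoo z^-1 q / (qpochoo (z ^+ 2)^-1 q * qpochoo (z ^+ 2 * q) q)
   * qpochoo (q ^+ (2 * r + 1)) (q ^+ (2 * r + 1))
   * (qpochsoo [:: z ^+ (2 * r + 1) * q ^+ (2 * r + 1 - i);
                   z ^- (2 * r + 1) * q ^+ i] (q ^+ (2 * r + 1))
      + z ^ (2 * i%:Z - 1 - 2 * r%:Z)
        * qpochsoo [:: z ^+ (2 * r + 1) * q ^+ i;
                       z ^- (2 * r + 1) * q ^+ (2 * r + 1 - i)]
            (q ^+ (2 * r + 1)))).
Proof.
have lim := chain_cvg hi q0 q1 z0 hU hW.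
have z20 : z ^+ 2 != 0 by rewrite expf_neq0.
have z21 := onem_expz_neq0 q0 z20 (qpochoo_factor_neq0 q1 hU)
  (qpochoo_factor_neq0 q1 hW).
have z1 := onem_zq q0 z21.
have [M M0 MP] := summand_bound hr hi q0 q1 z0 z1.
pose P k := (qpoch q q k)^-1; pose poo := qpochoo q q.
have qq1 n := onem_qqX n q1.
have poo0 : poo != 0 := qpochoo_neq0 q1 qq1.
have [M1 M10 M1P] : exists2 M : C, 0 < M & forall k, `|P k| <= M :=
  qpochq_inv_bounded q0 q1.
pose a (N : nat) (k : Lambda r.-1) :=
  poo * poo * (P (N%:Z - entry k 1) * P (N%:Z + entry k r.-1)).
(* The added 1 gives [1 <= A], so that [g] dominates the summand itself and not only its
   truncations. *)
pose A := `|poo * poo| * (M1 * M1) + 1.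
have A0 : 0 <= A by rewrite addr_ge0// !mulr_ge0// ltW.
have aA N k : `|a N k| <= A.
  apply: (@le_trans _ _ (`|poo * poo| * (M1 * M1))); last by rewrite lerDl.
  by rewrite normrM ler_wpM2l// normrM ler_pM.
have A1 : 1 <= A by rewrite lerDr mulr_ge0// mulr_ge0// ltW.
have AE : A = (complex.Re A)%:C by rewrite RRe_real// ger0_real.
have A'0 : 0 <= complex.Re A by rewrite -lecR -AE.
pose g (k : Lambda r.-1) : C :=
  (M * complex.Re A * (h ^+ lambda_weight k * h ^+ lambda_weight k))%:C.
have gE k : g k = (M * (h ^+ lambda_weight k * h ^+ lambda_weight k))%:C * A.
  by rewrite [in RHS]AE -rmorphM /g mulrAC.
have acvg k : a N k @[N --> \oo] --> (1 : C).
  have -> : (1 : C) = poo * poo * (poo^-1 * poo^-1).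
    by rewrite mulrACA mulfV// mulr1.
  apply: cvgM; first exact: cvg_cst.
  by apply: cvgM; exact: cvg_qpoch_inv_shift.
apply: (@tannery_has_sum C _ (summand i q z) g
  (fun N k => summand i q z k * a N k) (lambda_box r.-1)).
- exact: uniq_lambda_box.
- exact: near_mem_lambda_box.
- move=> k; rewrite -[X in _ --> X]mulr1.
  by apply: cvgM; [exact: cvg_cst|exact: acvg].
- by move=> N k _; rewrite gE normrM ler_pM.
- move=> k; rewrite gE; apply: le_trans (MP k) _.
  by rewrite ler_peMr// (le_trans (normr_ge0 _) (MP k)).
- apply: (@small_tails_geometric R _ (@lambda_weight r.-1) (lambda_box r.-1)
    (3 ^+ r.-1)).
  + exact: uniq_lambda_box.
  + exact: lambda_box_weight.
  + by rewrite mulr_ge0.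
  + exact: sum_half_lambda.
have sumE : (fun N => \sum_(k <- lambda_box r.-1 N) summand i q z k * a N k)
    = (fun N => poo * poo * chain q P z (qpoch (z * q) q) N (shifts r i) N%:Z).
  apply/funext => N.
  rewrite -(@sum_lambda_box _ q z P (qpoch (z * q) q) r.-1 N).
  - rewrite mulr_sumr; apply: eq_bigr => k _.
    by rewrite chain_term_summand// mulrCA.
  - by move=> k; exact: qpochq_lt0.
  - exact: size_shifts.
rewrite sumE; exact: lim.
Qed.
End HasSum.

Theorem theorem4p6 (R : realType) (r i : nat) (q z : R[i])
    (hr : (2 <= r)%N) (hi : (1 <= i <= r)%N)
    (hq0 : q != 0) (hq : `|q| < 1) (hz : z != 0)
    (hsummand : forall k : Lambda r.-1,
      qpoch (z * q) q (entry k r.-1)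
        * \prod_(1 <= j < r.-1) qpoch q q (entry k j - entry k j.+1) != 0)
    (hprefactor : qpochsoo [:: 1 / z ^+ 2; z ^+ 2 * q] q != 0) :
  has_sum
    (fun k : Lambda r.-1 =>
       q ^ (\sum_(1 <= j < r) entry k j ^+ 2 + \sum_(i <= j < r) entry k j)
         * z ^ (2 * \sum_(1 <= j < r) entry k j)
       / (qpoch (z * q) q (entry k r.-1)
            * \prod_(1 <= j < r.-1) qpoch q q (entry k j - entry k j.+1)))
    (qpochoo (1 / z) q / qpochsoo [:: 1 / z ^+ 2; z ^+ 2 * q] q
       * qpochoo (q ^+ (2 * r + 1)) (q ^+ (2 * r + 1))
       * (qpochsoo [:: z ^+ (2 * r + 1) * q ^+ (2 * r + 1 - i);
                       z ^- (2 * r + 1) * q ^+ i] (q ^+ (2 * r + 1))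
          + z ^ (2 * i%:Z - 1 - 2 * r%:Z)
            * qpochsoo [:: z ^+ (2 * r + 1) * q ^+ i;
                           z ^- (2 * r + 1) * q ^+ (2 * r + 1 - i)]
                (q ^+ (2 * r + 1)))).
Proof.
have prefE : qpochsoo [:: 1 / z ^+ 2; z ^+ 2 * q] q
    = qpochoo (z ^+ 2)^-1 q * qpochoo (z ^+ 2 * q) q.
  by rewrite /qpochsoo big_cons big_seq1 div1r.
move: hprefactor; rewrite prefE mulf_eq0 negb_or => /andP[hU hW].
rewrite (div1r z).
exact: (@has_sum_summand R r i q z hr hi hq0 hq hz hU hW).
Qed.
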